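(* Let $d\ge1$ and let $\Theta_\sigma\in\mathcal{S}'(\mathbb{R}^{2d})$ be the distributional symplectic Fourier transform of $\Theta(x,\omega)=\mathrm{sinc}(x\omega)$, $(x,\omega)\in\mathbb{R}^d\times\mathbb{R}^d$. Then $\Theta_\sigma\notin L^\infty_{loc}(\mathbb{R}^{2d})$.
   Context: For $x,\omega\in\mathbb{R}^d$, $x\omega$ denotes the scalar product. $\mathrm{sinc}(t)=\frac{\sin(\pi t)}{\pi t}$ for $t\ne0$ and $\mathrm{sinc}(0)=1$. The symplectic Fourier transform on $\mathbb{R}^{2d}$ is $\mathcal{F}_\sigma F(\zeta)=\int_{\mathbb{R}^{2d}}e^{-2\pi i\sigma(\zeta,z)}F(z)\,dz$ with $\sigma((x,\omega),(\zeta_1,\zeta_2))=\omega\cdot\zeta_1-x\cdot\zeta_2$, extended to $\mathcal{S}'(\mathbb{R}^{2d})$. The claim means that the distribution $\Theta_\sigma$ is not given by a locally essentially bounded function. *)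

(* Defs.v *)
From HB Require Import structures.
From mathcomp Require Import all_boot all_order all_algebra.
From mathcomp Require Import all_classical all_reals all_analysis.
From mathcomp Require Import measurable_realfun.
From mathcomp Require Import complex.

Set Implicit Arguments.
Unset Strict Implicit.
Unset Printing Implicit Defensive.

Import Order.TTheory GRing.Theory Num.Theory.
Import numFieldNormedType.Exports.

Local Open Scope classical_set_scope.
Local Open Scope ring_scope.
Local Open Scope complex_scope.

(* Lebesgue measure on R^n, carried by n-tuples: the library has the product
   sigma-algebra on tuples but no n-fold power of a measure, so the measure on
   (n+1)-tuples is the image under (x, t) |-> x :: t of the product of the
   measures on R and on n-tuples. *)
Section lebesgue_tuple.
Context {R : realType}.
Local Notation M := (measurableTypeR R).

Definition tcons n (p : M * n.-tuple M) : n.+1.-tuple M :=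
  [tuple of p.1 :: p.2].

Lemma measurable_tcons n : measurable_fun [set: M * n.-tuple M] (@tcons n).
Proof. exact: measurable_cons. Qed.

HB.instance Definition _ n :=
  isMeasurableFun.Build _ _ _ _ (@tcons n) (@measurable_tcons n).

Definition tuncons n (t : n.+1.-tuple M) : M * n.-tuple M :=
  (thead t, [tuple of behead t]).

Lemma measurable_tuncons n : measurable_fun [set: n.+1.-tuple M] (@tuncons n).
Proof.
apply: measurable_fun_pair; first exact: measurable_tnth.
exact: measurable_behead.
Qed.

Lemma tconsK n : cancel (@tcons n) (@tuncons n).
Proof.
by move=> [x t]; rewrite /tuncons /tcons; congr pair; apply/val_inj.
Qed.

Section tuple_measureS.
Context n (mu : {sigma_finite_measure set (n.-tuple M) -> \bar R}).

Let mu1 : {measure set (M * n.-tuple M)%type -> \bar R} :=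
  (lebesgue_measure \x mu)%E.

Definition tuple_measureS (A : set (n.+1.-tuple M)) : \bar R :=
  (lebesgue_measure \x mu)%E (@tcons n @^-1` A).

Let tuple_measureS0 : tuple_measureS set0 = 0%E.
Proof. exact: (measure0 (pushforward mu1 (@tcons n))). Qed.

Let tuple_measureS_ge0 A : (0 <= tuple_measureS A)%E.
Proof. exact: (measure_ge0 mu1). Qed.

Let tuple_measureS_sigma_additive : semi_sigma_additive tuple_measureS.
Proof.
exact: (@measure_semi_sigma_additive _ _ _ (pushforward mu1 (@tcons n))).
Qed.

HB.instance Definition _ := isMeasure.Build _ _ _ tuple_measureS
  tuple_measureS0 tuple_measureS_ge0 tuple_measureS_sigma_additive.

Let tuple_measureS_sigma_finite : sigma_finite setT tuple_measureS.
Proof.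
have /sigma_finiteP[F [FT ndF Foo]] := sigma_finiteT (@lebesgue_measure R).
have /sigma_finiteP[G [GT ndG Goo]] := sigma_finiteT mu.
exists (fun k => @tuncons n @^-1` (F k `*` G k)).
  rewrite -preimage_bigcup -(preimage_setT (@tuncons n)) -setXTT FT GT.
  congr (_ @^-1` _); apply/seteqP; split=> -[x t] /=.
    move=> [[i _ Fix] [j _ Gjt]]; exists (maxn i j) => //; split.
    - by move: x Fix; exact/subsetPset/ndF/leq_maxl.
    - by move: t Gjt; exact/subsetPset/ndG/leq_maxr.
  by move=> [k _ []/= ? ?]; split; exists k.
move=> k; have [mF Fk] := Foo k; have [mG Gk] := Goo k; split.
  rewrite -[X in measurable X]setTI; apply: measurable_tuncons => //.
  exact: measurableX.
rewrite /tuple_measureS -comp_preimage.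
rewrite (_ : _ \o _ = id) ?preimage_id; last exact/funext/tconsK.
by rewrite product_measure1E// lte_mul_pinfty// ge0_fin_numE.
Qed.

HB.instance Definition _ := Measure_isSigmaFinite.Build _ _ _ tuple_measureS
  tuple_measureS_sigma_finite.

End tuple_measureS.

Fixpoint lebesgue_tuple n :
    {sigma_finite_measure set (n.-tuple M) -> \bar R} :=
  if n is m.+1 then tuple_measureS (lebesgue_tuple m) else \d_ [tuple].

End lebesgue_tuple.

(* R^n is 'rV[R]_n (which carries the topology and the normed space
   structure); measure-theoretic notions are read off n-tuples of
   coordinates. *)
Section integration.
Context {R : realType} {n : nat}.
Local Notation E := 'rV[R]_n.
Local Notation C := R[i].

Definition rowt (t : n.-tuple (measurableTypeR R)) : E := \row_i tnth t i.

Definition Cintegral (F : E -> C) : C :=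
  (\int[lebesgue_tuple n]_t complex.Re (F (rowt t))) +i*
  (\int[lebesgue_tuple n]_t complex.Im (F (rowt t))).

Definition Cmeasurable (F : E -> C) :=
  measurable_fun setT (fun t => complex.Re (F (rowt t))) /\
  measurable_fun setT (fun t => complex.Im (F (rowt t))).

Definition Linfty_loc (F : E -> C) := Cmeasurable F /\
  forall K : set E, compact K -> exists B : R,
    {ae lebesgue_tuple n, forall t,
      K (rowt t) -> Normc.normc (F (rowt t)) <= B}.

End integration.

Section distributions.
Context {R : realType} {n : nat}.
Local Notation E := 'rV[R]_n.
Local Notation C := R[i].

(* [iter_partial [:: i1; ..; ik] g] is d_{i1} .. d_{ik} g. *)
Definition iter_partial (s : seq 'I_n) (g : E -> R) : E -> R :=
  foldr (fun i h => fun x => 'D_(delta_mx ord0 i) h x) g s.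

Definition smooth (g : E -> R) := forall s : seq 'I_n,
  continuous (iter_partial s g) /\
  forall i x, derivable (iter_partial s g) x (delta_mx ord0 i).

Definition Csmooth (F : E -> C) :=
  smooth (fun x => complex.Re (F x)) /\ smooth (fun x => complex.Im (F x)).

Definition Citer_partial (s : seq 'I_n) (F : E -> C) (x : E) : C :=
  iter_partial s (fun y => complex.Re (F y)) x +i*
  iter_partial s (fun y => complex.Im (F y)) x.

(* |x^alpha d^s F(x)|, whose supremum over x is a Schwartz seminorm. *)
Definition schwartz_weight (alpha : {ffun 'I_n -> nat}) (s : seq 'I_n)
    (F : E -> C) (x : E) : R :=
  `|\prod_i x ord0 i ^+ alpha i| * Normc.normc (Citer_partial s F x).

Definition schwartz (F : E -> C) := Csmooth F /\
  forall alpha s, exists B : R, forall x, schwartz_weight alpha s F x <= B.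

Definition test_function (F : E -> C) :=
  Csmooth F /\ compact (closure [set x | F x != 0]).

(* Functionals are total; only their values on Schwartz functions matter. *)
Definition functional := (E -> C) -> C.

(* S'(R^n): functionals that are linear on S(R^n) and bounded there by
   c times the maximum of finitely many seminorms. *)
Definition tempered_distribution (T : functional) :=
  (forall (a : C) (F G : E -> C), schwartz F -> schwartz G ->
     T (fun x => a * F x + G x) = a * T F + T G) /\
  (exists (N : nat) (c : R), forall F : E -> C, schwartz F ->
     forall B : R,
     (forall (alpha : {ffun 'I_n -> nat}) (s : seq 'I_n) x,
        (\sum_i alpha i <= N)%N -> (size s <= N)%N ->
        schwartz_weight alpha s F x <= B) ->
     Normc.normc (T F) <= c * B).

Definition eq_distribution (T U : functional) :=
  forall F, schwartz F -> T F = U F.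

Definition regular_distribution (F : E -> C) : functional :=
  fun G => Cintegral (fun x => F x * G x).

(* A locally bounded function need not be integrable against a Schwartz
   function, so, as usual in D'(R^n), only compactly supported test functions
   are used. *)
Definition in_Linfty_loc (T : functional) := exists F : E -> C,
  Linfty_loc F /\
  forall G, test_function G -> T G = regular_distribution F G.

End distributions.
Arguments functional : clear implicits.

Section symplectic_fourier.
Context {R : realType} {d : nat}.
Local Notation E := 'rV[R]_(d + d).
Local Notation C := R[i].

Definition dotv (x y : 'rV[R]_d) : R := \sum_i x ord0 i * y ord0 i.

(* The point (x, omega) of R^2d is [row_mx x omega]. *)
Definition sympl (z w : E) : R :=
  dotv (rsubmx z) (lsubmx w) - dotv (lsubmx z) (rsubmx w).

Definition expi (t : R) : C := cos t +i* sin t.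

Definition sympl_fourier (F : E -> C) (zeta : E) : C :=
  Cintegral (fun z => expi (- (2 * pi * sympl zeta z)) * F z).

(* Since sympl is antisymmetric, the transpose of [sympl_fourier] for the
   bilinear pairing \int F G is G |-> sympl_fourier G (- z). *)
Definition sympl_fourier_distribution (T : functional R (d + d)) :
    functional R (d + d) :=
  fun G => T (fun z => sympl_fourier G (- z)).

Definition sinc (t : R) : R := if t == 0 then 1 else sin (pi * t) / (pi * t).

Definition Theta (z : E) : C := (sinc (dotv (lsubmx z) (rsubmx z)))%:C.

End symplectic_fourier.

(* Main.v *)
(* Write g^ for the cosine transform of an even function g.  For a bump phi, put
   G(z) = prod_j phi(k_j z_j) * prod_j phi(z_(d+j)).  Since
   sinc v is the integral of cos (pi t v) over 0 <= t <= 1, Fubini's theorem and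
   Fourier inversion give
     Theta_sigma(G) = C^d * int_0^1 prod_j A(k_j t / 2) dt,
     A(s) = int phi(s x) phi^(x) dx,
   with C > 0.  The function A is continuous with A(0) > 0, and A(s) >= k/s for
   large s.  Take k_0 = m large and the other k_j equal to a small constant: then
   m * Theta_sigma(G) >= c log m - c'.  If Theta_sigma were a locally bounded
   function, m * |Theta_sigma(G)| would be at most a constant times m * ||G||_1,
   which does not depend on m.  Only real parts are ever needed. *)

Require Import Defs.
From HB Require Import structures.
From mathcomp Require Import all_boot all_order all_algebra.
From mathcomp Require Import all_classical all_reals all_analysis.
From mathcomp Require Import measurable_realfun.
From mathcomp Require Import complex.
From mathcomp Require Import ring lra.

Set Implicit Arguments.
Unset Strict Implicit.
Unset Printing Implicit Defensive.

Import Order.TTheory GRing.Theory Num.Theory.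
Import numFieldNormedType.Exports.

Local Open Scope classical_set_scope.
Local Open Scope ring_scope.

Local Notation "f ^`()" := (derive1 f) : ring_scope.
Local Notation "f ^`( n )" := (derive1n n f) : ring_scope.

(** * Smooth functions of one variable *)

(** Two features fix the shape of the test functions. Stretching one coordinate by a factor [m] >= 1
    shrinks the support in that direction, so all the G lie in one box that does not depend on [m],
    and a single local bound of the supposed function serves the whole family. The sign of A, on the
    other hand, is controlled only near 0 and beyond 2 pi, because nothing is known of the sign of
    phi^ away from 0. The small constant dilations keep the other factors in the region near 0 for
    every t in [0, 1]. The first factor escapes control only for t below 4 pi / m, and since A is
    bounded that range contributes O(1/m), which is O(1) after multiplication by [m]. The logarithm
    is the integral of 1/t over the rest of [0, 1]. For the same reason C > 0 and A(0) > 0 cannot be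
    read off from a sign of phi^: both amount to the positivity of the integral of phi^, which is
    extracted from a Parseval identity. *)

Section smooth1.
Context {R : realType}.
Implicit Types (f g : R -> R) (n k : nat) (x a b : R).

Lemma derivable_derive1 f x : derivable f x 1 -> is_derive x 1 f (f^`() x).
Proof. by move=> /derivableP; rewrite derive1E. Qed.

Lemma is_derive_derive1 f df :
  (forall x, is_derive x 1 f (df x)) -> f^`() = df.
Proof. by move=> h; apply/funext => x; rewrite derive1E; case: (h x). Qed.

(** The recursion passes to the derivative of [f] instead of describing the n-th derivative, so that
    closure under products is an induction on [n] with the functions generalized, with no Leibniz
    formula. *)
Fixpoint derivable_n n f : Prop :=
  if n is m.+1 then (forall x, derivable f x 1) /\ derivable_n m f^`() else True.

Definition smooth1 f := forall n, derivable_n n f.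

Lemma derivable_nW n f : derivable_n n.+1 f -> derivable_n n f.
Proof.
elim: n f => //= n ih f [fd h]; split => //; apply: ih; exact: h.
Qed.

Lemma derivable_nD n f g :
  derivable_n n f -> derivable_n n g -> derivable_n n (fun x => f x + g x).
Proof.
elim: n f g => //= n ih f g [fd fh] [gd gh].
have h x : is_derive x 1 (fun x => f x + g x) (f^`() x + g^`() x).
  by apply: is_deriveD; exact: derivable_derive1.
split=> [x|]; first by case: (h x).
by rewrite (is_derive_derive1 h); exact: ih.
Qed.

Lemma derivable_nM n f g :
  derivable_n n f -> derivable_n n g -> derivable_n n (fun x => f x * g x).
Proof.
elim: n f g => // n ih f g fn gn.
have [fd fh] := fn; have [gd gh] := gn.
have h x : is_derive x 1 (fun x => f x * g x) (f x * g^`() x + g x * f^`() x).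
  by apply: is_deriveM; exact: derivable_derive1.
split=> [x|]; first by case: (h x).
rewrite (is_derive_derive1 h).
by apply: derivable_nD; apply: ih => //; exact: derivable_nW.
Qed.

Lemma derivable_n_cst n a : derivable_n n (fun=> a).
Proof.
elim: n a => //= n ih a; split=> [x|]; first exact: derivable_cst.
by rewrite (@is_derive_derive1 (fun=> a) (fun=> 0)).
Qed.

Lemma is_derive_affine f a b x : derivable f (a * x + b) 1 ->
  is_derive x 1 (fun x => f (a * x + b)) (a * f^`() (a * x + b)).
Proof.
move=> fd; have h := derivable_derive1 fd.
have h2 : is_derive x 1 (fun x : R => a * x + b) a.
  have -> : (fun x : R => a * x + b) = (a \*: id) \+ cst b by apply/funext.
  by apply: is_derive_eq; rewrite addr0 /GRing.scale /= mulr1.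
have := @is_derive1_comp _ f (fun x => a * x + b) x _ _ h h2.
by rewrite mulrC.
Qed.

Lemma derivable_n_affine n f a b :
  derivable_n n f -> derivable_n n (fun x => f (a * x + b)).
Proof.
elim: n f => // n ih f [fd fh].
have h x := is_derive_affine (fd (a * x + b)).
split=> [x|]; first by case: (h x).
rewrite (is_derive_derive1 h).
by apply: derivable_nM; [exact: derivable_n_cst | exact: ih].
Qed.

Lemma smooth1_derivable f n x : smooth1 f -> derivable f^`(n) x 1.
Proof.
move=> /(_ n.+1); elim: n f => [|n ih] f [fd fh]; first exact: fd.
by rewrite derive1Sn; exact: ih.
Qed.

Lemma smooth1_continuous f n : smooth1 f -> continuous f^`(n).
Proof.
by move=> sf x; apply/differentiable_continuous/derivable1_diffP/smooth1_derivable.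
Qed.

Lemma smooth1_derivable0 f x : smooth1 f -> derivable f x 1.
Proof. by move=> /(@smooth1_derivable f 0%N x); rewrite derive1n0. Qed.

Lemma smooth1_continuous0 f : smooth1 f -> continuous f.
Proof. by move=> /(@smooth1_continuous f 0%N); rewrite derive1n0. Qed.

Lemma smooth1_affine f a b : smooth1 f -> smooth1 (fun x => f (a * x + b)).
Proof. by move=> sf n; exact: derivable_n_affine. Qed.

Lemma smooth1M f g : smooth1 f -> smooth1 g -> smooth1 (fun x => f x * g x).
Proof. by move=> sf sg n; exact: derivable_nM. Qed.

End smooth1.
Arguments smooth1_derivable {R f} n%_N x.
Arguments smooth1_derivable0 {R f} x.
Arguments smooth1_continuous {R f} n%_N.
Arguments smooth1_continuous0 {R f}.

(** * A smooth even bump supported in [-1, 1] *)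

Section bump.
Context {R : realType}.
Implicit Types (n k : nat) (x : R).

(* The derivatives of exp(-1/x), extended by 0, are combinations of these. *)
Definition flat k x : R := if 0 < x then x^-1 ^+ k * expR (- x^-1) else 0.

Lemma flat_ge0 k x : 0 <= flat k x.
Proof.
rewrite /flat; case: ifPn => // x0.
by rewrite mulr_ge0 ?expR_ge0// exprn_ge0// invr_ge0 ltW.
Qed.

(** One term of the exponential series suffices: with y = 1/x, exp(y) >= y^(k+2) / (k+2)!. The order
    k+2 is chosen to leave a factor x^2, which makes the derivative at 0 vanish. *)
Lemma flat_le k x : flat k x <= k.+2`!%:R * x ^+ 2.
Proof.
rewrite /flat; case: ifPn => x0; last by rewrite mulr_ge0// sqr_ge0.
have y0 : 0 < x^-1 by rewrite invr_gt0.
have := expR_ge1Dxn k.+1 (ltW y0); rewrite expRN.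
move=> h0; have {h0} : x^-1 ^+ k.+2 / k.+2`!%:R <= expR x^-1.
  by apply: le_trans h0; rewrite lerDr.
rewrite ler_pdivrMr ?ltr0n ?fact_gt0// => h.
rewrite ler_pdivrMr ?expR_gt0//.
apply: (@le_trans _ _ (x ^+ 2 * x^-1 ^+ k.+2)).
  by rewrite -[k.+2]addn2 exprD mulrCA -exprMn divff ?gt_eqF// expr1n mulr1.
rewrite (_ : k.+2`!%:R * x ^+ 2 * expR x^-1 = x ^+ 2 * (expR x^-1 * k.+2`!%:R)).
  by rewrite ler_wpM2l ?sqr_ge0.
by ring.
Qed.

(** The function is locally 0 on the left and explicit on the right; at 0 the quadratic bound
    [flat_le] makes the difference quotient O(h). As the right-hand side stays in the family,
    smoothness follows by induction. *)
Lemma is_derive_flat k x :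
  is_derive x 1 (flat k) (flat k.+2 x - k%:R * flat k.+1 x).
Proof.
have [x0|x0|->] := ltgtP x 0.
- have -> : flat k.+2 x - k%:R * flat k.+1 x = 0.
    by rewrite /flat ltNge (ltW x0)/= mulr0 subrr.
  apply: (@near_eq_is_derive _ _ _ (cst 0)) => //.
  near=> y; rewrite /flat ltNge ltW//=.
  by near: y; exact: lt_nbhsl.
- apply: (@near_eq_is_derive _ _ _ ((@GRing.inv R) ^+ k * (expR \o (-%R \o @GRing.inv R)))) => //.
    near=> y; rewrite /flat ifT// /= ?fctE//.
    by near: y; exact: lt_nbhsr.
  have xN0 : x != 0 by rewrite gt_eqF.
  have hV : is_derive x 1 (@GRing.inv R) (- x ^- 2).
    split; first by apply: (@derivableV _ _ id).
    by rewrite (@deriveV _ _ id)// derive_id /GRing.scale/= mulr1.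
  have hE : is_derive x 1 (expR \o (-%R \o @GRing.inv R)) (expR (- x^-1) * x^-2).
    apply: is_derive1_comp; rewrite -[X in is_derive _ _ _ X]opprK.
    exact: is_deriveN.
  apply: is_derive_eq.
  rewrite /flat x0 /GRing.scale/= !fctE /=.
  rewrite -!exprVn; case: k => [|k] /=.
    by rewrite !mul0r mulr0 addr0 subr0 mul1r mulrC.
  by rewrite !exprS; ring.
- have -> : flat k.+2 0 - k%:R * flat k.+1 0 = 0 :> R.
    by rewrite /flat ltxx mulr0 subrr.
  have h : (fun h : R => h^-1 *: (flat k (h *: 1 + 0) - flat k 0)) h @[h --> 0^'] --> (0 : R).
    apply/cvgrPdist_le => /= e e0.
    near=> h.
    rewrite /GRing.scale/= mulr1 addr0 [flat k 0]/flat ltxx subr0 sub0r normrN normrM.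
    rewrite (ger0_norm (flat_ge0 _ _)) normfV.
    have h0 : h != 0 by near: h; exact: nbhs_dnbhs_neq.
    rewrite ler_pdivrMl ?normr_gt0//.
    apply: (le_trans (flat_le k h)).
    rewrite -normr_nat -[h ^+ 2]ger0_norm ?sqr_ge0// -normrM expr2 mulrA normrM mulrC.
    rewrite ler_wpM2l// normrM normr_nat.
    rewrite -ler_pdivlMl ?ltr0n ?fact_gt0//.
    near: h; apply: dnbhs0_le.
    by rewrite mulr_gt0// invr_gt0 ltr0n fact_gt0.
  split; first by apply/cvg_ex; exists 0.
  exact/cvg_lim.
Unshelve. all: by end_near. Qed.

Lemma smooth1_flat k : smooth1 (flat k).
Proof.
move=> n; elim: n k => //= n ih k.
split=> [x|]; first by case: (is_derive_flat k x).
rewrite (is_derive_derive1 (is_derive_flat k)).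
have -> : (fun x => flat k.+2 x - k%:R * flat k.+1 x) =
    (fun x => flat k.+2 x + (- k%:R) * flat k.+1 x).
  by apply/funext => x; rewrite mulNr.
by apply: derivable_nD => //; apply: derivable_nM => //; exact: derivable_n_cst.
Qed.

(** On (-1, 1) this is exp(-2 / (1 - x^2)). *)
Definition bump x : R := flat 0 (1 - x) * flat 0 (1 + x).

Lemma smooth1_bump : smooth1 bump.
Proof.
apply: smooth1M.
  have := smooth1_affine (-1) 1 (smooth1_flat 0).
  by congr smooth1; apply/funext => x; rewrite mulN1r addrC.
have := smooth1_affine 1 1 (smooth1_flat 0).
by congr smooth1; apply/funext => x; rewrite mul1r addrC.
Qed.

Lemma bump_ge0 x : 0 <= bump x.
Proof. by rewrite mulr_ge0 ?flat_ge0. Qed.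

Lemma bumpN x : bump (- x) = bump x.
Proof. by rewrite /bump opprK mulrC. Qed.

Lemma bump_out x : 1 <= `|x| -> bump x = 0.
Proof.
rewrite /bump /flat ler_normr => /orP[x1|x1].
  by rewrite ifN ?mul0r// -leNgt subr_le0.
by rewrite [X in _ * X]ifN ?mulr0// -leNgt; lra.
Qed.

Lemma flat0_le1 x : flat 0 x <= 1.
Proof.
rewrite /flat; case: ifPn => // x0; rewrite expr0 mul1r expR_le1.
by rewrite oppr_le0 invr_ge0 ltW.
Qed.

Lemma bump_le1 x : bump x <= 1.
Proof. by rewrite mulr_ile1 ?flat_ge0 ?flat0_le1. Qed.

(** Both 1 - x and 1 + x are at least 1/2, so each of the two factors is at least exp(-2). *)
Lemma bump_ge x : `|x| <= 2^-1 -> expR (- 4) <= bump x.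
Proof.
rewrite ler_norml => /andP[x1 x2].
have h y : 2^-1 <= y -> expR (- 2) <= flat 0 y.
  move=> y2; have y0 : 0 < y by lra.
  rewrite /flat y0 expr0 mul1r ler_expR lerN2.
  by rewrite -[leRHS]invrK lef_pV2// posrE invr_gt0.
have -> : expR (- 4) = expR (- 2) * expR (- 2) :> R by rewrite -expRD; congr expR; ring.
by rewrite ler_pM ?expR_ge0//; apply: h; lra.
Qed.

End bump.

(** * Real-valued Fubini theorems *)

Section real_fubini.
Context {R : realType}.

Lemma le_integrableR d (T : measurableType d) (mu : {measure set T -> \bar R})
    (f g : T -> R) : measurable_fun setT f ->
  mu.-integrable setT (EFin \o g) -> (forall x, `|f x| <= `|g x|) ->
  mu.-integrable setT (EFin \o f).
Proof.
move=> mf ig fg; apply: (le_integrable measurableT _ _ ig).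
  exact/measurable_EFinP.
by move=> x _ /=; rewrite lee_fin.
Qed.

Lemma integrable_measurable d (T : measurableType d)
    (mu : {measure set T -> \bar R}) (f : T -> R) :
  mu.-integrable setT (EFin \o f) -> measurable_fun setT f.
Proof. by move=> /measurable_int/measurable_EFinP. Qed.

Lemma EFin_Rintegral d (T : measurableType d) (mu : {measure set T -> \bar R})
    (f : T -> R) : mu.-integrable setT (EFin \o f) ->
  (\int[mu]_x f x)%:E = (\int[mu]_x (f x)%:E)%E.
Proof. by move=> fi; rewrite /Rintegral fineK//; exact: integrable_fin_num. Qed.

Context d1 d2 (T1 : measurableType d1) (T2 : measurableType d2).
Variable m1 : {sigma_finite_measure set T1 -> \bar R}.
Variable m2 : {sigma_finite_measure set T2 -> \bar R}.

Lemma integrable_prod (u : T1 -> R) (v : T2 -> R) :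
  m1.-integrable setT (EFin \o u) -> m2.-integrable setT (EFin \o v) ->
  (m1 \x m2)%E.-integrable setT (EFin \o (fun p => u p.1 * v p.2)).
Proof.
move=> iu iv; have mu := integrable_measurable iu; have mv := integrable_measurable iv.
apply/integrable12ltyP.
  apply/measurable_EFinP; apply: measurable_funM.
    exact: (measurableT_comp mu measurable_fst).
  exact: (measurableT_comp mv measurable_snd).
have h x : (\int[m2]_y `|(EFin \o (fun p => (u p.1 * v p.2)%R)) (x, y)|)%E =
    (`|u x|%:E * \int[m2]_y `|(v y)%:E|)%E.
  rewrite -ge0_integralZl//; last first.
    by apply/measurable_EFinP; exact: measurableT_comp.
  by apply: eq_integral => y _ /=; rewrite normrM EFinM.
under eq_integral do rewrite h.
have [_ iu2] := integrableP _ _ _ iu; have [_ iv2] := integrableP _ _ _ iv.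
have iv3 : (\int[m2]_y `|(v y)%:E|)%E \is a fin_num.
  by rewrite ge0_fin_numE//; exact: integral_ge0.
rewrite -(fineK iv3).
under eq_integral do rewrite muleC.
rewrite ge0_integralZl//.
- by rewrite lte_mul_pinfty// lee_fin fine_ge0// integral_ge0.
- by apply/measurable_EFinP; exact: measurableT_comp.
- by rewrite lee_fin fine_ge0// integral_ge0.
Qed.

Section swap.
Variable f : T1 * T2 -> R.
Hypothesis fi : (m1 \x m2)%E.-integrable setT (EFin \o f).

Section sections1.
Hypothesis f1 : forall x, m2.-integrable setT (EFin \o (fun y => f (x, y))).

Let F_E : EFin \o (fun x => \int[m2]_y f (x, y)) =
  (fun x => \int[m2]_y (EFin \o f) (x, y))%E.
Proof. by apply/funext => x /=; rewrite EFin_Rintegral. Qed.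

(** The real inner integral agrees with the extended one where the section is integrable. Asking
    this of every section, and not almost every one, makes [F_E] an equality of functions. *)
Lemma Rfubini12 : \int[m1]_x (\int[m2]_y f (x, y)) = \int[(m1 \x m2)%E]_p f p.
Proof.
by rewrite {1}/Rintegral; congr fine; rewrite -integral12_prod_meas1// -F_E.
Qed.

End sections1.

Hypothesis f2 : forall y, m1.-integrable setT (EFin \o (fun x => f (x, y))).

Lemma Rfubini21 : \int[m2]_y (\int[m1]_x f (x, y)) = \int[(m1 \x m2)%E]_p f p.
Proof.
rewrite {1}/Rintegral; congr fine; rewrite -integral21_prod_meas1//.
by apply: eq_integral => y _; rewrite EFin_Rintegral.
Qed.

End swap.

Section kernel.
Variables (u : T1 -> R) (v : T2 -> R) (c : T1 * T2 -> R).
Hypothesis iu : m1.-integrable setT (EFin \o u).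
Hypothesis iv : m2.-integrable setT (EFin \o v).
Hypothesis mc : measurable_fun setT c.
Hypothesis c1 : forall p, `|c p| <= 1.

Let mcx x : measurable_fun setT (fun y => c (x, y)).
Proof. exact: (measurableT_comp mc (measurable_pair1 x)). Qed.

Let mcy y : measurable_fun setT (fun x => c (x, y)).
Proof. exact: (measurableT_comp mc (measurable_pair2 y)). Qed.

(** A kernel bounded by 1 leaves the product [u p.1 * v p.2] as dominating function. In every use
    the kernel is a cosine of a phase that couples the two variables. *)
Lemma integrable_kernel :
  (m1 \x m2)%E.-integrable setT (EFin \o (fun p => u p.1 * (c p * v p.2))).
Proof.
apply: (le_integrableR _ (integrable_prod iu iv)) => [|p].
  apply: measurable_funM; last apply: measurable_funM => //.
    exact: (measurableT_comp (integrable_measurable iu) measurable_fst).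
  exact: (measurableT_comp (integrable_measurable iv) measurable_snd).
rewrite !normrM ler_wpM2l// -[leRHS]mul1r ler_wpM2r//; exact: c1.
Qed.

Lemma integrable_kernel1 x : m2.-integrable setT (EFin \o (fun y => c (x, y) * v y)).
Proof.
apply: (le_integrableR _ iv) => [|y].
  apply: measurable_funM => //; exact: (integrable_measurable iv).
by rewrite normrM -[leRHS]mul1r ler_wpM2r//; exact: c1.
Qed.

Lemma integrable_kernel2 y : m1.-integrable setT (EFin \o (fun x => c (x, y) * u x)).
Proof.
apply: (le_integrableR _ iu) => [|x].
  apply: measurable_funM => //; exact: (integrable_measurable iu).
by rewrite normrM -[leRHS]mul1r ler_wpM2r//; exact: c1.
Qed.

Let k1 x : m2.-integrable setT (EFin \o (fun y => u x * (c (x, y) * v y))).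
Proof.
have := integrableZl measurableT (u x) (integrable_kernel1 x).
by congr integrable; apply/funext => y /=; rewrite EFinM.
Qed.

Let k2 y : m1.-integrable setT (EFin \o (fun x => u x * (c (x, y) * v y))).
Proof.
have := integrableZl measurableT (v y) (integrable_kernel2 y).
by congr integrable; apply/funext => x /=; rewrite -EFinM; congr EFin; ring.
Qed.

Lemma Rfubini_kernel1 : \int[m1]_x (u x * \int[m2]_y (c (x, y) * v y)) =
  \int[(m1 \x m2)%E]_p (u p.1 * (c p * v p.2)).
Proof.
rewrite -(Rfubini12 integrable_kernel k1).
apply: eq_Rintegral => x _; rewrite -RintegralZl//.
exact: integrable_kernel1.
Qed.

Lemma Rfubini_kernel2 : \int[m2]_y (v y * \int[m1]_x (c (x, y) * u x)) =
  \int[(m1 \x m2)%E]_p (u p.1 * (c p * v p.2)).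
Proof.
rewrite -(Rfubini21 integrable_kernel k2).
apply: eq_Rintegral => y _; rewrite -RintegralZl//.
  by apply: eq_Rintegral => x _ /=; ring.
exact: integrable_kernel2.
Qed.

Lemma Rfubini_kernel : \int[m1]_x (u x * \int[m2]_y (c (x, y) * v y)) =
  \int[m2]_y (v y * \int[m1]_x (c (x, y) * u x)).
Proof. by rewrite Rfubini_kernel1 Rfubini_kernel2. Qed.

End kernel.

End real_fubini.

(** * Affine changes of variable and parity for Lebesgue integrals on the line *)

Section affine_substitution.
Context {R : realType}.
Notation mu := (@lebesgue_measure R).
Implicit Types (f : R -> R) (a b : R).

Let affine a b : measurableTypeR R -> measurableTypeR R := fun x => a * x + b.

Let measurable_affine a b : measurable_fun setT (affine a b).
Proof. by apply: measurable_funD => //; exact: measurable_funM. Qed.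

Let measurable_opp :
  measurable_fun setT (-%R : measurableTypeR R -> measurableTypeR R).
Proof. exact: oppr_measurable. Qed.

(** By uniqueness of Lebesgue measure it is enough to compare the rescaled image measure with it on
    half-open intervals. *)
Let lebesgue_measure_affine a b (A : set (measurableTypeR R)) : 0 < a ->
  measurable A -> mu A = (a%:E * mu (affine a b @^-1` A))%E.
Proof.
move=> a0 mA.
rewrite (@lebesgue_measure_unique _
  (mscale (NngNum (ltW a0)) (pushforward mu (affine a b))))//.
move=> _ [[s t]] _ <-.
suff : mu `]s, t]%classic = (a%:E * mu (affine a b @^-1` `]s, t]%classic))%E by [].
rewrite (_ : affine a b @^-1` `]s, t]%classic = `](s - b) / a, (t - b) / a]%classic); last first.
  apply/seteqP; split=> x /=; rewrite !in_itv/= ltr_pdivrMr// ler_pdivlMr// /affine;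
    rewrite ltrBlDr lerBrDr; by rewrite [x * a]mulrC.
rewrite !lebesgue_measure_itv/= !lte_fin ltr_pM2r ?invr_gt0// ltrD2r.
case: ifPn => _; last by rewrite mule0.
by rewrite -!EFinB -EFinM; congr EFin; field; rewrite gt_eqF.
Qed.

Lemma integrable_affine f a b : 0 < a ->
  mu.-integrable setT (EFin \o f) ->
  mu.-integrable setT (EFin \o (fun x => f (a * x + b))) /\
  \int[mu]_x f x = a * \int[mu]_x f (a * x + b).
Proof.
move=> a0 fi.
have mf := integrable_measurable fi.
have ge0E (g : R -> \bar R) : measurable_fun setT g -> (forall x, 0 <= g x)%E ->
    (\int[mu]_x g x = a%:E * \int[mu]_x g (a * x + b)%R)%E.
  move=> mg g0.
  rewrite -(ge0_integral_pushforward (measurable_affine a b) mu measurableT mg)//.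
  rewrite -(ge0_integral_mscale _ _ (NngNum (ltW a0)))//.
  by apply: eq_measure_integral => A mA _; exact: lebesgue_measure_affine.
have fai : mu.-integrable setT (EFin \o (fun x => f (a * x + b))).
  apply/integrableP; split.
    by apply/measurable_EFinP; exact: (measurableT_comp mf (measurable_affine a b)).
  have [_] := integrableP _ _ _ fi.
  rewrite ge0E//; last by apply/measurable_EFinP; exact: measurableT_comp.
  (* If the composite had infinite integral, multiplying by [a] > 0 would make the integral of [f]
     infinite too. *)
  move=> h; rewrite ltNge leye_eq; apply/eqP => h2; move: h.
  by rewrite h2 gt0_muley ?lte_fin.
split => //.
apply: EFin_inj; rewrite EFinM !EFin_Rintegral//.
rewrite integralE ge0E//; last exact/measurable_funepos/measurable_EFinP.
rewrite [X in (_ - X)%E]ge0E//; last exact/measurable_funeneg/measurable_EFinP.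
rewrite [in RHS]integralE.
have Pf := integrable_pos_fin_num measurableT fai.
have Nf := integrable_neg_fin_num measurableT fai.
have distr (P Q : \bar R) : P \is a fin_num -> Q \is a fin_num ->
    (a%:E * P - a%:E * Q = a%:E * (P - Q))%E.
  by case: P => [p| |]//; case: Q => [q| |]// _ _; rewrite -!EFinM -!EFinB mulrBr.
rewrite -(distr _ _ Pf Nf); congr (_ - _)%E; congr (_ * _)%E;
    apply: eq_integral => x _.
  by rewrite (funepos_comp (EFin \o f) (fun x => a * x + b)).
by rewrite (funeneg_comp (EFin \o f) (fun x => a * x + b)).
Qed.

Lemma Rintegral_opp f : mu.-integrable setT (EFin \o f) ->
  \int[mu]_x f (- x) = \int[mu]_x f x.
Proof.
move=> fi; have mf := integrable_measurable fi.
have ge0E (g : measurableTypeR R -> \bar R) : measurable_fun setT g ->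
    (forall x, 0 <= g x)%E -> (\int[mu]_x g (- x)%R = \int[mu]_x g x)%E.
  move=> mg g0; rewrite -(ge0_integral_pushforward measurable_opp mu measurableT mg)//.
  by apply: eq_measure_integral => A mA _; exact: lebesgue_measureN.
rewrite /Rintegral; congr fine; rewrite integralE [RHS]integralE; congr (_ - _)%E.
  rewrite -(ge0E ((EFin \o f)^\+)%E)//.
    by apply: eq_integral => x _; rewrite (funepos_comp (EFin \o f) -%R).
  exact/measurable_funepos/measurable_EFinP.
rewrite -(ge0E ((EFin \o f)^\-)%E)//.
  by apply: eq_integral => x _; rewrite (funeneg_comp (EFin \o f) -%R).
exact/measurable_funeneg/measurable_EFinP.
Qed.

Lemma Rintegral_odd f : mu.-integrable setT (EFin \o f) ->
  (forall x, f (- x) = - f x) -> \int[mu]_x f x = 0.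
Proof.
move=> fi fN; have := Rintegral_opp fi.
under eq_Rintegral do rewrite fN -mulN1r.
by rewrite RintegralZl// mulN1r; lra.
Qed.

End affine_substitution.

(** * Integration over tuples *)

Section transfer.
Context {R : realType} d1 d2 (T1 : measurableType d1) (T2 : measurableType d2).
Variables (m1 : {measure set T1 -> \bar R}) (m2 : {measure set T2 -> \bar R}).
Variable phi : T1 -> T2.
Hypothesis ge0_transfer : forall g : T2 -> \bar R, measurable_fun setT g ->
  (forall x, 0 <= g x)%E -> (\int[m2]_x g x = \int[m1]_x g (phi x))%E.
Variable f : T2 -> R.
Hypothesis mf : measurable_fun setT f.

Lemma integrable_transfer : m1.-integrable setT (EFin \o (f \o phi)) ->
  m2.-integrable setT (EFin \o f).
Proof.
move=> /integrableP[_ fi]; apply/integrableP; split; first exact/measurable_EFinP.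
by rewrite ge0_transfer//; apply/measurable_EFinP; exact: measurableT_comp.
Qed.

(** A change of variables known for nonnegative functions is applied to the positive and negative
    parts. It is stated abstractly because it serves both [tcons] and [tcat]. *)
Lemma Rintegral_transfer : \int[m2]_x f x = \int[m1]_x f (phi x).
Proof.
rewrite /Rintegral; congr fine; rewrite integralE [RHS]integralE; congr (_ - _)%E.
  rewrite (ge0_transfer (g := (EFin \o f)^\+%E))//.
    by apply: eq_integral => x _; rewrite (funepos_comp (EFin \o f) phi).
  exact/measurable_funepos/measurable_EFinP.
rewrite (ge0_transfer (g := (EFin \o f)^\-%E))//.
  by apply: eq_integral => x _; rewrite (funeneg_comp (EFin \o f) phi).
exact/measurable_funeneg/measurable_EFinP.
Qed.

End transfer.

Section tuple_integral.
Context {R : realType}.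
Local Notation M := (measurableTypeR R).
Local Notation mu := (@lebesgue_measure R).
Local Notation lambda := (@lebesgue_tuple R).

Lemma ge0_integral_tuple0 (g : 0.-tuple M -> \bar R) : measurable_fun setT g ->
  (forall x, 0 <= g x)%E -> (\int[lambda 0]_t g t = g [tuple])%E.
Proof. by move=> mg g0; rewrite integral_dirac// diracT mul1e. Qed.

Lemma ge0_integral_tupleS n (g : n.+1.-tuple M -> \bar R) :
  measurable_fun setT g -> (forall x, 0 <= g x)%E ->
  (\int[lambda n.+1]_t g t = \int[(mu \x lambda n)%E]_p g (tcons p))%E.
Proof.
move=> mg g0.
rewrite -(ge0_integral_pushforward (@measurable_tcons R n) _ measurableT mg)//.
Qed.

Lemma integrable_tupleS n (f : n.+1.-tuple M -> R) : measurable_fun setT f ->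
  (mu \x lambda n)%E.-integrable setT (EFin \o (fun p => f (tcons p))) ->
  (lambda n.+1).-integrable setT (EFin \o f).
Proof.
move=> mf fi.
exact: (@integrable_transfer _ _ _ _ _ (mu \x lambda n)%E (lambda n.+1) _
  (@ge0_integral_tupleS n) f mf fi).
Qed.

Lemma Rintegral_tupleS n (f : n.+1.-tuple M -> R) : measurable_fun setT f ->
  \int[lambda n.+1]_t f t = \int[(mu \x lambda n)%E]_p f (tcons p).
Proof.
move=> mf.
exact: (@Rintegral_transfer _ _ _ _ _ (mu \x lambda n)%E (lambda n.+1) _
  (@ge0_integral_tupleS n) f mf).
Qed.

Lemma measurable_Rsum d (T : measurableType d) (I : Type) (s : seq I)
    (h : I -> T -> R) : (forall i, measurable_fun setT (h i)) ->
  measurable_fun setT (fun x => \sum_(i <- s) h i x).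
Proof. by move=> mh; exact: measurable_sum. Qed.

Lemma measurable_cos_fun d (T : measurableType d) (h : T -> R) :
  measurable_fun setT h -> measurable_fun setT (fun x => cos (h x)).
Proof.
move=> mh; apply: (measurableT_comp _ mh).
by apply: continuous_measurable_fun; exact: continuous_cos.
Qed.

Lemma measurable_tensor n (f : 'I_n -> R -> R) :
  (forall i, measurable_fun setT (f i)) ->
  measurable_fun setT (fun t : n.-tuple M => \prod_i f i (tnth t i)).
Proof.
move=> mf; apply: measurable_prod => i _.
exact: (measurableT_comp (mf i) (measurable_tnth i)).
Qed.

Lemma tensor_cons n (f : 'I_n.+1 -> R -> R) (p : M * n.-tuple M) :
  \prod_i f i (tnth (tcons p) i) =
  f ord0 p.1 * \prod_i f (lift ord0 i) (tnth p.2 i).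
Proof.
rewrite big_ord_recl; congr (_ * _); apply: eq_bigr => i _.
by rewrite tnthS.
Qed.

Lemma dot_cons n (th : 'I_n.+1 -> R) (p : M * n.-tuple M) :
  \sum_i th i * tnth (tcons p) i =
  th ord0 * p.1 + \sum_i th (lift ord0 i) * tnth p.2 i.
Proof.
rewrite big_ord_recl; congr (_ + _); apply: eq_bigr => i _.
by rewrite tnthS.
Qed.

Lemma integrable_tensor n (f : 'I_n -> R -> R) :
  (forall i, mu.-integrable setT (EFin \o f i)) ->
  (lambda n).-integrable setT
    (EFin \o (fun t : n.-tuple M => \prod_i f i (tnth t i))).
Proof.
elim: n f => [|n ih] f fi.
  apply/integrableP; split.
    by apply/measurable_EFinP; apply: measurable_tensor => -[].
  rewrite ge0_integral_tuple0//= ?big_ord0 ?ltry//.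
  apply/measurable_EFinP; apply: measurableT_comp => //.
  by apply: measurable_tensor => -[].
apply: integrable_tupleS.
  by apply: measurable_tensor => i; exact: integrable_measurable (fi i).
have := integrable_prod (fi ord0) (ih _ (fun i => fi (lift ord0 i))).
by congr integrable; apply/funext => p /=; rewrite tensor_cons.
Qed.

Lemma measurable_dot n (th : 'I_n -> R) :
  measurable_fun setT (fun t : n.-tuple M => \sum_i th i * tnth t i).
Proof.
apply: measurable_Rsum => i; apply: measurable_funM => //.
exact: measurable_tnth.
Qed.

(* Since the factors are even, the sine contributions vanish one variable at a
   time. *)
Lemma Rintegral_tensor_cos n (f : 'I_n -> R -> R) (th : 'I_n -> R) (a : R) :
  (forall i, mu.-integrable setT (EFin \o f i)) ->
  (forall i x, f i (- x) = f i x) ->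
  \int[lambda n]_t
    (cos (a + \sum_i th i * tnth t i) * \prod_i f i (tnth t i)) =
  cos a * \prod_i \int[mu]_x (cos (th i * x) * f i x).
Proof.
elim: n f th a => [|n ih] f th a fi fN.
  rewrite big_ord0 mulr1 /Rintegral.
  rewrite (eq_integral (cst (cos a)%:E)); first by rewrite integral_dirac// diracT mul1e.
  by move=> t _; rewrite !big_ord0 addr0 mulr1.
rewrite Rintegral_tupleS; last first.
  apply: measurable_funM.
    by apply: measurable_cos_fun; apply: measurable_funD => //; exact: measurable_dot.
  by apply: measurable_tensor => i; exact: integrable_measurable (fi i).
pose c (p : M * n.-tuple M) :=
  cos (a + th ord0 * p.1 + \sum_i th (lift ord0 i) * tnth p.2 i).
have mc : measurable_fun setT c.
  apply: measurable_cos_fun; apply: measurable_funD.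
    by apply: measurable_funD => //; apply: measurable_funM.
  exact: (measurableT_comp (measurable_dot _) measurable_snd).
have fi0 := fi ord0.
have fiT := integrable_tensor (fun i => fi (lift ord0 i)).
transitivity (\int[mu]_x (f ord0 x * \int[lambda n]_t
    (c (x, t) * \prod_i f (lift ord0 i) (tnth t i)))).
  rewrite Rfubini_kernel1//; last by move=> p; exact: cos_max.
  apply: eq_Rintegral => p _; rewrite tensor_cons dot_cons /c addrA; ring.
pose Q := \prod_i \int[mu]_x (cos (th (lift ord0 i) * x) * f (lift ord0 i) x).
(* The induction hypothesis is taken at phase [a + th ord0 * x]; this is why the statement carries a
   free phase [a]. *)
transitivity (\int[mu]_x (f ord0 x * (cos (a + th ord0 * x) * Q))).
  apply: eq_Rintegral => x _; congr (_ * _).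
  by rewrite -ih//; move=> i y; exact: fN.
rewrite big_ord_recl -/Q.
have mth k : measurable_fun setT (fun x : M => k * x) by exact: measurable_funM.
have ic : mu.-integrable setT (EFin \o (fun x => cos (th ord0 * x) * f ord0 x)).
  apply: (le_integrableR _ fi0) => [|x].
    apply: measurable_funM; last exact: integrable_measurable fi0.
    exact: measurable_cos_fun.
  by rewrite normrM -[leRHS]mul1r ler_wpM2r// cos_max.
have isn : mu.-integrable setT (EFin \o (fun x => sin (th ord0 * x) * f ord0 x)).
  apply: (le_integrableR _ fi0) => [|x].
    apply: measurable_funM; last exact: integrable_measurable fi0.
    apply: (measurableT_comp _ (mth _)).
    by apply: continuous_measurable_fun; exact: continuous_sin.
  by rewrite normrM -[leRHS]mul1r ler_wpM2r// sin_max.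
transitivity (\int[mu]_x (cos a * Q * (cos (th ord0 * x) * f ord0 x) -
    sin a * Q * (sin (th ord0 * x) * f ord0 x))).
  by apply: eq_Rintegral => x _; rewrite cosD; ring.
have iZ k (g : R -> R) : mu.-integrable setT (EFin \o g) ->
    mu.-integrable setT (EFin \o (fun x => k * g x)).
  by move=> /(integrableZl measurableT k); congr integrable; apply/funext => x /=.
rewrite RintegralB//; [|exact: iZ|exact: iZ].
rewrite !RintegralZl// [X in _ - _ * X]Rintegral_odd//.
  by rewrite mulr0 subr0; ring.
by move=> x; rewrite fN mulrN sinN mulNr.
Qed.

Lemma Rintegral_tensor n (f : 'I_n -> R -> R) :
  (forall i, mu.-integrable setT (EFin \o f i)) ->
  (forall i x, f i (- x) = f i x) ->
  \int[lambda n]_t \prod_i f i (tnth t i) = \prod_i \int[mu]_x f i x.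
Proof.
move=> fi fN; have := Rintegral_tensor_cos (fun=> 0) 0 fi fN.
rewrite cos0 mul1r => h; transitivity (\prod_i \int[mu]_x (cos (0 * x) * f i x)).
  rewrite -h; apply: eq_Rintegral => t _.
  rewrite [X in cos (0 + X)]big1 ?addr0 ?cos0 ?mul1r// => i _.
  by rewrite mul0r.
by apply: eq_bigr => i _; apply: eq_Rintegral => x _; rewrite mul0r cos0 mul1r.
Qed.

Definition tcat m n (p : m.-tuple M * n.-tuple M) : (m + n).-tuple M :=
  [tuple of p.1 ++ p.2].

Lemma tnth_tcatl m n (p : m.-tuple M * n.-tuple M) i :
  tnth (tcat p) (lshift n i) = tnth p.1 i.
Proof. by rewrite tnth_lshift. Qed.

Lemma tnth_tcatr m n (p : m.-tuple M * n.-tuple M) i :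
  tnth (tcat p) (rshift m i) = tnth p.2 i.
Proof. by rewrite tnth_rshift. Qed.

Lemma measurable_tcat m n : measurable_fun setT (@tcat m n).
Proof.
apply/measurable_fun_tnthP => i; rewrite -(splitK i); case: (fintype.split i) => j /=.
  rewrite (_ : _ \o _ = fun p => tnth p.1 j); last first.
    by apply/funext => p /=; rewrite tnth_tcatl.
  exact: (measurableT_comp (measurable_tnth j) measurable_fst).
rewrite (_ : _ \o _ = fun p => tnth p.2 j); last first.
  by apply/funext => p /=; rewrite tnth_tcatr.
exact: (measurableT_comp (measurable_tnth j) measurable_snd).
Qed.

(** The measure on tuples is built one coordinate at a time, so the splitting of R^(m+n) is an
    induction on [m]: Tonelli isolates the first coordinate on both sides. It is needed to integrate
    x and omega separately. *)
Lemma ge0_integral_tcat m n (g : (m + n).-tuple M -> \bar R) :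
  measurable_fun setT g -> (forall x, 0 <= g x)%E ->
  (\int[lambda (m + n)]_t g t =
   \int[(lambda m \x lambda n)%E]_p g (tcat p))%E.
Proof.
elim: m g => [|m ih] g mg g0.
  have mgc : measurable_fun setT (fun p => g (@tcat 0 n p)).
    exact: (measurableT_comp mg (@measurable_tcat 0 n)).
  rewrite fubini_tonelli1//.
  rewrite ge0_integral_tuple0; last 2 first.
  - exact: measurable_fun_fubini_tonelli_F.
  - by move=> x; exact: integral_ge0.
  apply: eq_integral => t _; congr g; exact: val_inj.
have mgc : measurable_fun setT (fun p => g (@tcat m.+1 n p)).
  exact: (measurableT_comp mg (@measurable_tcat m.+1 n)).
have mgt : measurable_fun setT (fun p => g (@tcons R (m + n) p)).
  exact: (measurableT_comp mg (@measurable_tcons R (m + n))).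
rewrite (@ge0_integral_tupleS (m + n))// fubini_tonelli1// fubini_tonelli1//.
rewrite ge0_integral_tupleS; last 2 first.
- exact: measurable_fun_fubini_tonelli_F.
- by move=> x; exact: integral_ge0.
rewrite [RHS]fubini_tonelli1; last 2 first.
- apply: (measurableT_comp _ (@measurable_tcons R m)).
  exact: measurable_fun_fubini_tonelli_F.
- by move=> x; exact: integral_ge0.
apply: eq_integral => x _; rewrite /fubini_F.
have mgx : measurable_fun setT (fun t => g (@tcons R (m + n) (x, t))).
  exact: (measurableT_comp mgt (measurable_pair1 x)).
rewrite ih// fubini_tonelli1//; last first.
  exact: (measurableT_comp mgx (@measurable_tcat m n)).
apply: eq_integral => s _; apply: eq_integral => u _.
by congr g; exact: val_inj.
Qed.

End tuple_integral.

(** * Cosine transforms *)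

Section cosine_transform.
Context {R : realType}.
Local Notation mu := (@lebesgue_measure R).
Local Notation M := (measurableTypeR R).
Local Notation Rintegrable f := (mu.-integrable setT (EFin \o f)).
Implicit Types (f g h : R -> R) (L s t w : R).

Lemma measurable_continuous f : continuous f -> measurable_fun [set: M] f.
Proof. exact: continuous_measurable_fun. Qed.

Lemma integrableZ k f : Rintegrable f -> Rintegrable (fun x => k * f x).
Proof.
by move=> /(integrableZl measurableT k); congr integrable; apply/funext => x /=.
Qed.

Lemma notin_supp f L x : (forall x, L <= `|x| -> f x = 0) ->
  x \notin `[- L, L]%classic -> f x = 0.
Proof.
move=> fL xL; apply: fL; rewrite leNgt; apply/negP; rewrite ltr_norml => /andP[x1 x2].
by move/negP: xL; apply; rewrite inE/= in_itv/= !ltW.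
Qed.

Lemma integrable_csupp f L : continuous f ->
  (forall x, L <= `|x| -> f x = 0) -> Rintegrable f.
Proof.
move=> cf fL.
have fi : mu.-integrable `[- L, L] (EFin \o f).
  apply: continuous_compact_integrable; first exact: segment_compact.
  exact: continuous_subspaceT.
have := (@integrable_mkcond _ M R mu `[- L, L]%classic (EFin \o f)
  (measurable_itv _)).1 fi; congr integrable.
apply/funext => x; rewrite /patch; case: ifPn => // xL.
by rewrite /= (notin_supp fL xL).
Qed.

Lemma Rintegral_csupp f L : (forall x, L <= `|x| -> f x = 0) ->
  \int[mu]_x f x = \int[mu]_(x in `[- L, L]) f x.
Proof.
move=> fL; rewrite [RHS]Rintegral_mkcond; apply: eq_Rintegral => x _.
by rewrite /patch; case: ifPn => // xL; rewrite (notin_supp fL xL).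
Qed.

Lemma Rintegral_ge_cst f a b k : Rintegrable f -> (forall x, 0 <= f x) ->
  a <= b -> (forall x, a <= x <= b -> k <= f x) ->
  k * (b - a) <= \int[mu]_x f x.
Proof.
move=> fi f0 ab kf.
have -> : k * (b - a) = \int[mu]_(x in `[a, b]) k.
  rewrite Rintegral_cst// /= lebesgue_measure_itv/= lte_fin.
  case: ltP => //= ba; by rewrite (_ : b - a = 0)//; apply/eqP; rewrite subr_eq0 eq_le ab ba.
have fab : mu.-integrable `[a, b] (EFin \o f) by apply: integrableS fi.
apply: (@le_trans _ _ (\int[mu]_(x in `[a, b]) f x)).
  apply: le_Rintegral => //.
  apply: continuous_compact_integrable; first exact: segment_compact.
  by apply: continuous_subspaceT => x; exact: cvg_cst.
rewrite Rintegral_mkcond; apply: le_Rintegral => //.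
  have := (@integrable_mkcond _ M R mu `[a, b]%classic (EFin \o f)
    (measurable_itv _)).1 fab; congr integrable.
  by apply/funext => x; rewrite /patch/=; case: ifPn.
by move=> x _; rewrite /patch; case: ifPn.
Qed.

(** Dominated convergence with majorant |h|. The kernel is a cosine for [fcos] and a dilated bump
    for [corr]. *)
Lemma continuous_Rkernel (c : R -> R -> R) h : Rintegrable h ->
  (forall l, measurable_fun [set: M] (c l)) -> (forall x, continuous (c ^~ x)) ->
  (forall l x, `|c l x| <= 1) ->
  continuous (fun l => \int[mu]_x (c l x * h x)).
Proof.
move=> hi mc cc c1 l.
apply: (@continuity_under_integral _ _ _ mu (fun l x => c l x * h x) setT _
  (l - 1) (l + 1) _ _ (fun x => `|h x|)) => //.
- move=> y _; apply: (le_integrableR _ hi) => [|x].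
    by apply: measurable_funM => //; exact: integrable_measurable hi.
  by rewrite normrM -[leRHS]mul1r ler_wpM2r.
- apply: aeW => x _ y _; apply: cvgM; last exact: cvg_cst.
  exact: cc.
- exact: integrable_norm.
- by move=> y _; apply: aeW => x _; rewrite normrM -[leRHS]mul1r ler_wpM2r.
- by rewrite inE/= in_itv/= ltrBlDr ltrDl ltr01.
Qed.

Definition fcos f w := \int[mu]_x (cos (2 * pi * w * x) * f x).

Lemma continuous_cosM (k : R) : continuous (fun x : R => cos (k * x)).
Proof.
move=> x; apply: continuous_comp; last exact: continuous_cos.
exact: mulrl_continuous.
Qed.

Lemma measurable_cosM (k : R) : measurable_fun [set: M] (fun x : R => cos (k * x)).
Proof. by apply: measurable_continuous; exact: continuous_cosM. Qed.

Lemma integrable_cosM f k : Rintegrable f -> Rintegrable (fun x => cos (k * x) * f x).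
Proof.
move=> fi; apply: (le_integrableR _ fi) => [|x].
  apply: measurable_funM; first exact: measurable_cosM.
  exact: integrable_measurable fi.
by rewrite normrM -[leRHS]mul1r ler_wpM2r// cos_max.
Qed.

Lemma fcosN f w : fcos f (- w) = fcos f w.
Proof.
by apply: eq_Rintegral => x _; rewrite mulrN mulNr cosN.
Qed.

Lemma continuous_fcos f : Rintegrable f -> continuous (fcos f).
Proof.
move=> fi; apply: (@continuous_Rkernel (fun w x => cos (2 * pi * w * x))) => //.
- by move=> l; exact: measurable_cosM.
- move=> x.
  have -> : (fun w => cos (2 * pi * w * x)) = (fun w => cos (2 * pi * x * w)).
    by apply/funext => w; rewrite mulrAC.
  exact: continuous_cosM.
- by move=> l x; exact: cos_max.
Qed.

Lemma normr_Rintegral_cosM f k : Rintegrable f ->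
  `|\int[mu]_x (cos (k * x) * f x)| <= \int[mu]_x `|f x|.
Proof.
move=> fi; apply: le_trans (le_normr_Rintegral measurableT (integrable_cosM k fi)) _.
apply: le_Rintegral => //.
- exact: integrable_norm (integrable_cosM k fi).
- exact: integrable_norm.
- by move=> x _; rewrite normrM -[leRHS]mul1r ler_wpM2r// cos_max.
Qed.

(** Moving the bound from L to L + 1 guarantees a full neighbourhood of x on which f vanishes, so no
    differentiability is required. *)
Lemma derive1_supp f L : (forall x, L <= `|x| -> f x = 0) ->
  forall x, L + 1 <= `|x| -> f^`() x = 0.
Proof.
move=> fL x Lx; rewrite derive1E (@near_eq_derive _ _ _ _ (cst 0)) ?derive_cst//.
have : L < `|x| by apply: lt_le_trans Lx; rewrite ltrDl.
move=> {}Lx; near=> y; apply: fL; apply/ltW; near: y.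
exact: (cvgr_gt _ (@norm_continuous _ _ x)).
Unshelve. all: by end_near. Qed.

(* Two integrations by parts, performed at once. *)
Lemma Rintegral_cos_derive2 f L k : smooth1 f -> 0 < L ->
  (forall x, L <= `|x| -> f x = 0) ->
  k ^+ 2 * \int[mu]_x (cos (k * x) * f x) =
  - \int[mu]_x (cos (k * x) * f^`(2) x).
Proof.
move=> sf L0 fL.
have f1L := derive1_supp fL; have f2L := derive1_supp f1L.
have fi : Rintegrable f by apply: (integrable_csupp _ fL); exact: (smooth1_continuous0 sf).
have cf2 := smooth1_continuous 2 sf.
rewrite derive1nS derive1n1 in cf2 *.
have f2i : Rintegrable f^`()^`() by exact: (integrable_csupp cf2 f2L).
apply/eqP; rewrite -addr_eq0 -RintegralZl//; last exact: integrable_cosM.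
rewrite -RintegralD//; [|exact: integrableZ (integrable_cosM _ _)|exact: integrable_cosM].
(* The boundary term of both integrations by parts: on differentiating it the two terms in k f'
   sin(k x) cancel and [F'] remains. It vanishes at both ends of the interval of integration. *)
pose F : R -> R := fun x => f^`() x * cos (k * x) + k * f x * sin (k * x).
pose F' : R -> R := fun x => k ^+ 2 * (cos (k * x) * f x) + cos (k * x) * f^`()^`() x.
have dF (x : R) : is_derive x 1 F (F' x).
  have h0 : is_derive x 1 f (f^`() x).
    by apply: derivable_derive1; exact: (smooth1_derivable0 x sf).
  have h1 : is_derive x 1 f^`() (f^`()^`() x).
    by apply: derivable_derive1; have := smooth1_derivable 1 x sf; rewrite derive1n1.
  have hk : is_derive x 1 ( *%R k) k.
    by have := is_deriveZ k (@is_derive_id _ _ x 1); rewrite /GRing.scale/= mulr1.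
  have hc : is_derive x 1 (fun x => cos (k * x)) (- sin (k * x) * k).
    exact: (is_derive1_comp (is_derive_cos (k * x)) hk).
  have hs : is_derive x 1 (fun x => sin (k * x)) (cos (k * x) * k).
    exact: (is_derive1_comp (is_derive_sin (k * x)) hk).
  have h0k : is_derive x 1 (fun x => k * f x) (k * f^`() x) by exact: (is_deriveZ k h0).
  have := is_deriveD (is_deriveM h1 hc) (is_deriveM h0k hs).
  rewrite [X in is_derive _ _ _ X -> _](_ : _ = F' x) => [//|].
  by rewrite /F' /GRing.scale/=; ring.
have LL : - (L + 1 + 1) < L + 1 + 1 by lra.
have F'0 (x : R) : L + 1 + 1 <= `|x| -> F' x = 0.
  move=> Lx; have fx : f x = 0 by apply: fL; apply: le_trans Lx; lra.
  by rewrite /F' f2L// fx !mulr0 addr0.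
have cF (x : R) : {for x, continuous F}.
  by apply/differentiable_continuous/derivable1_diffP; case: (dF x).
have cF' : continuous F'.
  move=> x; apply: cvgD.
    apply: cvgM; first exact: cvg_cst.
    by apply: cvgM; [exact: continuous_cosM | exact: (smooth1_continuous0 sf)].
  by apply: cvgM; [exact: continuous_cosM | exact: cf2].
rewrite -[X in X == _]/(\int[mu]_x F' x) (Rintegral_csupp F'0) /Rintegral.
rewrite (@continuous_FTC2 _ _ F)//.
- have FL (x : R) : `|x| = L + 1 + 1 -> F x = 0.
    move=> xL; rewrite /F f1L ?xL; last by lra.
    by rewrite fL ?xL; [ring | lra].
  rewrite !FL ?subee//; rewrite ?normrN ger0_norm//; lra.
- exact: continuous_subspaceT.
- split; first by move=> x _; case: (dF x).
  + by apply: cvg_at_right_filter; exact: cF.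
  + by apply: cvg_at_left_filter; exact: cF.
- by move=> x _; rewrite derive1E; case: (dF x).
Qed.

Lemma integrable_oneDsqrV : Rintegrable (fun x => (1 + x ^+ 2)^-1).
Proof.
have c : continuous (fun x : R => (1 + x ^+ 2)^-1) by exact: continuous_oneDsqrV.
have p x : 0 <= (1 + x ^+ 2)^-1 :> R by rewrite invr_ge0 addr_ge0// sqr_ge0.
apply/integrableP; split; first by apply/measurable_EFinP; exact: measurable_continuous.
under eq_integral do rewrite /= ger0_norm//.
rewrite ge0_symfun_integralT//; last by move=> x /=; rewrite sqrrN.
by rewrite -set_itvcy integral0y_oneDsqr -EFinM ltry.
Qed.

(** Two integrations by parts give (1 + w^2) |f^(w)| <= ||f||_1 + ||f''||_1, since w^2 <= (2 pi
    w)^2; the majorant is a multiple of 1 / (1 + w^2). *)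
Lemma integrable_fcos f L : smooth1 f -> 0 < L ->
  (forall x, L <= `|x| -> f x = 0) -> Rintegrable (fcos f).
Proof.
move=> sf L0 fL.
have fi : Rintegrable f by apply: (integrable_csupp _ fL); exact: (smooth1_continuous0 sf).
have f2i : Rintegrable f^`(2).
  apply: (integrable_csupp (smooth1_continuous 2 sf) (L := L + 1 + 1)).
  by rewrite derive1nS derive1n1; exact: (derive1_supp (derive1_supp fL)).
pose K := \int[mu]_x `|f x| + \int[mu]_x `|f^`(2) x|.
have K0 : 0 <= K by rewrite addr_ge0// Rintegral_ge0.
apply: (le_integrableR _ (integrableZ K integrable_oneDsqrV)) => [|w].
  by apply: measurable_continuous; exact: continuous_fcos.
have w0 : 0 < 1 + w ^+ 2 by rewrite ltr_pwDl// sqr_ge0.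
rewrite [leRHS]ger0_norm; last by rewrite mulr_ge0// invr_ge0 ltW.
rewrite ler_pdivlMr//.
have h1 := normr_Rintegral_cosM (2 * pi * w) fi.
have h2 := normr_Rintegral_cosM (2 * pi * w) f2i.
have e := Rintegral_cos_derive2 (2 * pi * w) sf L0 fL.
have : (2 * pi * w) ^+ 2 * `|fcos f w| <= \int[mu]_x `|f^`(2) x|.
  by rewrite -[X in X * _]ger0_norm ?sqr_ge0// -normrM /fcos e normrN.
have : w ^+ 2 <= (2 * pi * w) ^+ 2.
  rewrite !exprMn ler_peMl ?sqr_ge0// -exprMn -[leLHS](expr1n _ 2).
  by rewrite lerXn2r ?nnegrE//; have := @pi_ge2 R; lra.
move=> /(ler_wpM2r (normr_ge0 (fcos f w))) h3 h4.
rewrite mulrDr mulr1 lerD// mulrC; exact: le_trans h3 h4.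
Qed.

Lemma cos_ge_cos1 (x : R) : `|x| <= 1 -> cos 1 <= cos x.
Proof.
move=> x1; have -> : cos x = cos `|x|.
  by case: (leP 0 x) => x0; [rewrite ger0_norm | rewrite ltr0_norm// cosN].
have pi2 := @pi_ge2 R.
rewrite le_eqVlt; have [->|nx] := eqVneq `|x| 1; first by rewrite eqxx.
apply/orP; right; rewrite ltr_cos ?in_itv/= ?normr_ge0//=; [|lra|lra].
by rewrite lt_neqAle nx.
Qed.

Lemma Rdominated_cvg (u : nat -> R -> R) f h : Rintegrable h ->
  (forall n, measurable_fun [set: M] (u n)) -> measurable_fun [set: M] f ->
  (forall x, u ^~ x @ \oo --> f x) -> (forall n x, `|u n x| <= `|h x|) ->
  (fun n => \int[mu]_x u n x) @ \oo --> \int[mu]_x f x.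
Proof.
move=> hi mu_ mf uf uh.
have [||||//|fi _] := @dominated_convergence _ _ _ mu setT measurableT
  (fun n => EFin \o u n) (EFin \o f) (fun x => `|h x|%:E).
- by move=> n; exact/measurable_EFinP.
- exact/measurable_EFinP.
- apply: aeW => x _; apply: cvg_EFin; first exact: nearW.
  exact: uf.
- exact: integrable_norm.
- by apply: aeW => x n _; rewrite /= lee_fin.
by rewrite -EFin_Rintegral// => /fine_cvg.
Qed.

End cosine_transform.

(** * Fourier inversion and the correlation of a bump with its transform *)

Section inversion.
Context {R : realType}.
Local Notation mu := (@lebesgue_measure R).
Local Notation M := (measurableTypeR R).
Local Notation Rintegrable f := (mu.-integrable setT (EFin \o f)).
Local Notation bump := (@bump R).
Implicit Types (f g h : R -> R) (L s t w : R).

Lemma continuous_bump : continuous bump.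
Proof. exact/smooth1_continuous0/smooth1_bump. Qed.

Lemma normr_bump_le1 (x : R) : `|bump x| <= 1.
Proof. by rewrite ger0_norm ?bump_ge0// bump_le1. Qed.

Lemma integrable_bump : Rintegrable bump.
Proof. exact: integrable_csupp continuous_bump (@bump_out R). Qed.

Lemma integrable_fcos_bump : Rintegrable (fcos bump).
Proof. exact: integrable_fcos smooth1_bump ltr01 (@bump_out R). Qed.

Lemma bump_dilate_out (k x : R) : 0 < k -> k^-1 <= `|x| -> bump (k * x) = 0.
Proof.
move=> k0 kx; apply: bump_out.
by rewrite normrM (gtr0_norm k0) mulrC -ler_pdivrMr// div1r.
Qed.

Lemma continuous_bump_dilate (k : R) : continuous (fun x => bump (k * x)).
Proof.
move=> x; apply: continuous_comp; last exact: continuous_bump.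
exact: mulrl_continuous.
Qed.

Lemma integrable_bump_dilate (k : R) : 0 < k -> Rintegrable (fun x => bump (k * x)).
Proof.
move=> k0; apply: (integrable_csupp (@continuous_bump_dilate k) (L := k^-1)) => x.
exact: bump_dilate_out.
Qed.

Lemma measurable_cos_prod : measurable_fun setT
  (fun p : M * M => cos (2 * pi * p.1 * p.2)).
Proof.
apply: measurable_cos_fun; apply: measurable_funM => //.
by apply: measurable_funM => //; exact: measurable_cst.
Qed.

(** The multiplication formula of Fourier analysis. It drives the inversion formula, the positivity
    of the integral of [fcos bump], and the lower bound of [corr]. *)
Lemma Rintegral_cos_swap f g : Rintegrable f -> Rintegrable g ->
  \int[mu]_x (f x * fcos g x) = \int[mu]_y (g y * fcos f y).
Proof.
move=> fi gi.
have := Rfubini_kernel fi gi measurable_cos_prod (fun p => cos_max _).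
rewrite /fcos /= => ->; apply: eq_Rintegral => y _; congr (_ * _).
by apply: eq_Rintegral => x _; rewrite mulrAC.
Qed.

Lemma fcos_bump_dilate (k v : R) : 0 < k ->
  fcos (fun x => bump (k^-1 * x)) v = k * fcos bump (k * v).
Proof.
move=> k0; have kN0 : k != 0 by rewrite gt_eqF.
have kV0 : 0 < k^-1 by rewrite invr_gt0.
have fi := integrable_cosM (2 * pi * v) (integrable_bump_dilate kV0).
have [_ e] := integrable_affine 0 k0 fi.
rewrite /fcos e; congr (_ * _).
by apply: eq_Rintegral => x _; rewrite addr0 mulKf//; congr (cos _ * _); ring.
Qed.

Lemma fcos_cosM f t s : Rintegrable f ->
  fcos (fun w => cos (2 * pi * t * w) * f w) s =
  2^-1 * (fcos f (s - t) + fcos f (s + t)).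
Proof.
move=> fi; rewrite /fcos -RintegralD//; [|exact: integrable_cosM..].
rewrite -RintegralZl//; last first.
  have := integrableD measurableT (integrable_cosM (2 * pi * (s - t)) fi)
    (integrable_cosM (2 * pi * (s + t)) fi).
  by congr integrable; apply/funext => x.
apply: eq_Rintegral => w _.
have -> : 2 * pi * (s - t) * w = 2 * pi * s * w - 2 * pi * t * w by ring.
have -> : 2 * pi * (s + t) * w = 2 * pi * s * w + 2 * pi * t * w by ring.
by rewrite cosB cosD; field.
Qed.

Lemma normr_fcos f w : Rintegrable f -> `|fcos f w| <= \int[mu]_x `|f x|.
Proof. exact: normr_Rintegral_cosM. Qed.

Lemma measurable_fcos f : Rintegrable f -> measurable_fun [set: M] (fcos f).
Proof. by move=> fi; apply: measurable_continuous; exact: continuous_fcos. Qed.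

(** As k grows, k phi^(k (s - t)) concentrates at s = t: it is an approximate identity up to its
    total mass. The substitution s = x/k + t moves the parameter into the argument of [g], ready for
    dominated convergence. *)
Lemma Rintegral_rescaled_kernel g (k t : R) : 0 < k -> Rintegrable g ->
  Rintegrable (fun s => g s * (k * fcos bump (k * (s - t)))) /\
  \int[mu]_s (g s * (k * fcos bump (k * (s - t)))) =
  \int[mu]_x (fcos bump x * g (k^-1 * x + t)).
Proof.
move=> k0 gi; have kN0 : k != 0 by rewrite gt_eqF.
have hi : Rintegrable (fun s => g s * (k * fcos bump (k * (s - t)))).
  pose K := \int[mu]_x `|bump x|.
  apply: (le_integrableR _ (integrableZ (k * K) gi)) => [|s].
    apply: measurable_funM; first exact: integrable_measurable gi.
    apply: measurable_funM; first exact: measurable_cst.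
    apply: measurableT_comp; first exact: (measurable_fcos integrable_bump).
    by apply: measurable_funM => //; apply: measurable_funB.
  rewrite normrM mulrC [leRHS]normrM ler_wpM2r// !normrM ler_wpM2l//.
  apply: le_trans (normr_fcos _ integrable_bump) _.
  exact: ler_norm.
split=> //; have kV0 : 0 < k^-1 by rewrite invr_gt0.
rewrite (integrable_affine t kV0 hi).2 -RintegralZl//; last first.
  exact: (integrable_affine t kV0 hi).1.
by apply: eq_Rintegral => x _; rewrite addrK mulVKf// [g _ * _]mulrC !mulrA mulVf// mul1r.
Qed.

(* Multiplying by bump (w / n) and letting n tend to infinity; the constant is
   the integral of [fcos bump] over [bump 0]. *)
Lemma fcos_inversion g L t : smooth1 g -> 0 < L ->
  (forall x, L <= `|x| -> g x = 0) -> (forall x, `|g x| <= 1) ->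
  (forall x, g (- x) = g x) ->
  bump 0 * fcos (fcos g) t = (\int[mu]_x fcos bump x) * g t.
Proof.
move=> sg L0 gL g1 gN.
have cg := smooth1_continuous0 sg.
have gi : Rintegrable g := integrable_csupp cg gL.
have fgi : Rintegrable (fcos g) := integrable_fcos sg L0 gL.
have bi := integrable_fcos_bump.
pose k n : R := n.+1%:R.
have k0 n : 0 < k n by rewrite /k ltr0n.
have kV0 n : 0 < (k n)^-1 by rewrite invr_gt0.
have kV : (k n)^-1 @[n --> \oo] --> (0 : R).
  exact: cvg_harmonic.
pose u n w := cos (2 * pi * t * w) * bump ((k n)^-1 * w).
have ui n : Rintegrable (u n) by exact/integrable_cosM/integrable_bump_dilate.
(* The same sequence is given two limits. Here the cutoff tends to [bump 0] pointwise, with the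
   integrable [fcos g] as majorant. *)
have lim1 : (fun n => \int[mu]_w (u n w * fcos g w)) @ \oo -->
    \int[mu]_w (cos (2 * pi * t * w) * bump 0 * fcos g w).
  apply: (Rdominated_cvg fgi) => [n||w|n w].
  - apply: measurable_funM; first exact: integrable_measurable (ui n).
    exact: measurable_fcos.
  - apply: measurable_funM; last exact: measurable_fcos.
    by apply: measurable_funM; [exact: measurable_cosM | exact: measurable_cst].
  - apply: cvgM; last exact: cvg_cst.
    apply: cvgM; first exact: cvg_cst.
    have : (k n)^-1 * w @[n --> \oo] --> 0 * w.
      by apply: cvgM => //; exact: cvg_cst.
    by rewrite mul0r => h; apply: continuous_cvg h; exact: continuous_bump.
  - rewrite normrM -[leRHS]mul1r ler_wpM2r// normrM.
    by rewrite mulr_ile1 ?cos_max ?normr_bump_le1.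
(* Here the transform is moved from [g] onto [u n], where the factor cos(2 pi t w) turns the
   rescaled kernel into the half-sum of its translates to t and -t. Evenness of [g] later merges the
   two values. *)
have lim2 : (fun n => \int[mu]_w (u n w * fcos g w)) @ \oo -->
    \int[mu]_x (fcos bump x * (2^-1 * (g t + g (- t)))).
  rewrite (_ : (fun n => _) = (fun n => \int[mu]_x (fcos bump x *
      (2^-1 * (g ((k n)^-1 * x + t) + g ((k n)^-1 * x - t)))))); last first.
    apply/funext => n; rewrite Rintegral_cos_swap//.
    have [h1 e1] := Rintegral_rescaled_kernel t (k0 n) gi.
    have [h2 e2] := Rintegral_rescaled_kernel (- t) (k0 n) gi.
    have hs (a : R) : Rintegrable (fun x => fcos bump x * g ((k n)^-1 * x + a)).
      apply: (le_integrableR _ bi) => [|x].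
        apply: measurable_funM; first exact: measurable_fcos integrable_bump.
        apply: measurableT_comp; first exact: measurable_continuous cg.
        by apply: measurable_funD => //; exact: measurable_funM.
      by rewrite normrM -[leRHS]mulr1 ler_wpM2l.
    transitivity (2^-1 * (\int[mu]_s (g s * (k n * fcos bump (k n * (s - t)))) +
        \int[mu]_s (g s * (k n * fcos bump (k n * (s - - t)))))).
      rewrite -RintegralD// -RintegralZl//; last first.
        by have := integrableD measurableT h1 h2; congr integrable; apply/funext.
      apply: eq_Rintegral => s _.
      rewrite fcos_cosM; last exact: integrable_bump_dilate.
      by rewrite !fcos_bump_dilate// opprK; ring.
    rewrite e1 e2 -RintegralD// -RintegralZl//; last first.
      by have := integrableD measurableT (hs t) (hs (- t)); congr integrable; apply/funext.
    by apply: eq_Rintegral => x _; ring.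
  have gm (a : R) n : measurable_fun [set: M] (fun x => g ((k n)^-1 * x + a)).
    apply: measurableT_comp; first exact: measurable_continuous cg.
    by apply: measurable_funD => //; exact: measurable_funM.
  apply: (Rdominated_cvg bi) => [n||x|n x].
  - apply: measurable_funM; first exact: measurable_fcos integrable_bump.
    by apply: measurable_funM; [exact: measurable_cst | apply: measurable_funD; exact: gm].
  - apply: measurable_funM; [exact: measurable_fcos integrable_bump | exact: measurable_cst].
  - have ga (a : R) : g ((k n)^-1 * x + a) @[n --> \oo] --> g a.
      have : (k n)^-1 * x + a @[n --> \oo] --> 0 * x + a.
        by apply: cvgD; [apply: cvgM => //; exact: cvg_cst | exact: cvg_cst].
      by rewrite mul0r add0r => h; apply: continuous_cvg h; exact: cg.
    apply: cvgM; first exact: cvg_cst.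
    by apply: cvgM; [exact: cvg_cst | apply: cvgD; exact: ga].
  - rewrite normrM -[leRHS]mulr1 ler_wpM2l// normrM ger0_norm//.
    rewrite ler_pdivrMl// mulr1; apply: le_trans (ler_normD _ _) _.
    by rewrite -[2]/(1 + 1) lerD.
have := cvg_unique _ lim1 lim2.
rewrite gN => /(_ (@Rhausdorff R)) e.
transitivity (\int[mu]_w (cos (2 * pi * t * w) * bump 0 * fcos g w)).
  rewrite /fcos -RintegralZl//; last exact: integrable_cosM.
  by apply: eq_Rintegral => w _; ring.
rewrite e -RintegralZr//.
by apply: eq_Rintegral => x _; field.
Qed.

Lemma bump0_gt0 : 0 < bump 0.
Proof.
by apply: lt_le_trans (bump_ge _); rewrite ?expR_gt0// normr0 invr_ge0.
Qed.

Let m : R := cos 1 * expR (- 4).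

Let m_gt0 : 0 < m.
Proof. by rewrite mulr_gt0 ?expR_gt0// cos1_gt0. Qed.

Let cos_bump_ge0 (x a : R) : (`|x| <= 1 -> `|a| <= 1) -> 0 <= cos a * bump x.
Proof.
move=> xa; have [x1|x1] := leP `|x| 1; last by rewrite bump_out ?mulr0// ltW.
by rewrite mulr_ge0 ?bump_ge0// (le_trans _ (cos_ge_cos1 (xa x1)))// ltW// cos1_gt0.
Qed.

Let cos_bump_ge (x a : R) : `|x| <= 2^-1 -> `|a| <= 1 -> m <= cos a * bump x.
Proof.
move=> x1 a1; rewrite ler_pM ?expR_ge0 ?(ltW (cos1_gt0 _))//.
  exact: cos_ge_cos1.
exact: bump_ge.
Qed.

Let two_pi_gt0 : 0 < 2 * pi :> R.
Proof. by rewrite mulr_gt0// pi_gt0. Qed.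

(** At these frequencies the phase stays in [-1, 1] over the whole support, so the integrand is
    nonnegative, and it is at least [m] on [-1/2, 1/2], of length 1. *)
Lemma fcos_bump_ge w : `|w| <= (2 * pi)^-1 -> m <= fcos bump w.
Proof.
move=> w1.
have := @Rintegral_ge_cst _ (fun x => cos (2 * pi * w * x) * bump x) (- 2^-1) 2^-1 m.
rewrite (_ : 2^-1 - - 2^-1 = 1); last by field.
rewrite mulr1; apply.
- exact: integrable_cosM integrable_bump.
- move=> x; apply: cos_bump_ge0 => x1; rewrite normrM mulr_ile1// normrM.
  by rewrite (gtr0_norm two_pi_gt0) mulrC -ler_pdivlMr// div1r.
- by lra.
- move=> x /andP[x1 x2]; have {x1 x2}x1 : `|x| <= 2^-1 by rewrite ler_norml x1.
  apply: cos_bump_ge => //; rewrite normrM mulr_ile1//; last by apply: le_trans x1 _; lra.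
  by rewrite normrM (gtr0_norm two_pi_gt0) mulrC -ler_pdivlMr// div1r.
Qed.

(** With I0 this integral, inversion and the multiplication formula give the Parseval identity
    phi(0) ||phi^||_2^2 = I0 ||phi||_2^2. The left side is positive because phi^ is bounded below
    near 0, and ||phi||_2^2 >= 0, so I0 > 0. *)
Lemma Rintegral_fcos_bump_gt0 : 0 < \int[mu]_x fcos bump x.
Proof.
set I0 := Rintegral _ _ _.
have inv t : bump 0 * fcos (fcos bump) t = I0 * bump t.
  by apply: (fcos_inversion t smooth1_bump ltr01 (@bump_out R)) => x;
    [exact: normr_bump_le1 | exact: bumpN].
have sqi f : Rintegrable f -> (exists K : R, forall x, `|f x| <= K) ->
    Rintegrable (fun x => f x * f x).
  move=> fi [K fK]; apply: (le_integrableR _ (integrableZ K fi)) => [|x].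
    by apply: measurable_funM; exact: integrable_measurable fi.
  by rewrite !normrM ler_wpM2r//; apply: le_trans (fK x) (ler_norm _).
have bbi := sqi _ integrable_bump (ex_intro _ _ normr_bump_le1).
have ffb : exists K : R, forall x, `|fcos bump x| <= K.
  by exists (\int[mu]_x `|bump x|) => x; exact: normr_fcos integrable_bump.
have ffi := sqi _ integrable_fcos_bump ffb.
have e : bump 0 * \int[mu]_x (fcos bump x * fcos bump x) =
    I0 * \int[mu]_x (bump x * bump x).
  rewrite (Rintegral_cos_swap integrable_fcos_bump integrable_bump).
  rewrite -!RintegralZl//; last first.
    have := integrableZ (I0 / bump 0) bbi; congr integrable; apply/funext => x /=.
    have -> : fcos (fcos bump) x = I0 / bump 0 * bump x.
      by rewrite mulrAC -inv mulrAC divff ?mul1r// gt_eqF// bump0_gt0.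
    by congr EFin; ring.
  by apply: eq_Rintegral => x _; rewrite mulrCA inv; ring.
have ff : 0 < \int[mu]_x (fcos bump x * fcos bump x).
  have p0 : 0 < (2 * pi)^-1 :> R by rewrite invr_gt0.
  apply: (@lt_le_trans _ _ (m * m * ((2 * pi)^-1 - 0))).
    by rewrite subr0; exact: mulr_gt0 (mulr_gt0 m_gt0 m_gt0) p0.
  apply: Rintegral_ge_cst => //.
  - by move=> x; rewrite -expr2 sqr_ge0.
  - exact: ltW.
  - move=> x /andP[x0 x1]; have hx : m <= fcos bump x by apply: fcos_bump_ge; rewrite ger0_norm.
    by rewrite ler_pM// ltW.
have bb : 0 <= \int[mu]_x (bump x * bump x).
  by apply: Rintegral_ge0 => x _; rewrite -expr2 sqr_ge0.
have := mulr_gt0 bump0_gt0 ff; rewrite e => /[dup] h.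
by rewrite pmulr_lgt0// lt_neqAle bb andbT eq_sym; apply/eqP => b0; move: h; rewrite b0 mulr0 ltxx.
Qed.

(** The function A of the overview. *)
Definition corr s := \int[mu]_x (bump (s * x) * fcos bump x).

Lemma continuous_corr : continuous corr.
Proof.
apply: (@continuous_Rkernel _ (fun s x => bump (s * x))).
- exact: integrable_fcos_bump.
- by move=> s; apply: measurable_continuous; exact: continuous_bump_dilate.
- move=> x; rewrite (_ : (fun s => _) = (fun s => bump (x * s))).
    exact: continuous_bump_dilate.
  by apply/funext => s; rewrite mulrC.
- by move=> s x; exact: normr_bump_le1.
Qed.

Lemma corr0_gt0 : 0 < corr 0.
Proof.
rewrite /corr; under eq_Rintegral do rewrite mul0r.
rewrite RintegralZl//; last exact: integrable_fcos_bump.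
by rewrite mulr_gt0 ?bump0_gt0 ?Rintegral_fcos_bump_gt0.
Qed.

Lemma normr_corr s : `|corr s| <= \int[mu]_x `|fcos bump x|.
Proof.
have fi := integrable_fcos_bump.
have hi : Rintegrable (fun x => bump (s * x) * fcos bump x).
  apply: (le_integrableR _ fi) => [|x].
    apply: measurable_funM; last exact: integrable_measurable fi.
    by apply: measurable_continuous; exact: continuous_bump_dilate.
  by rewrite normrM -[leRHS]mul1r ler_wpM2r// normr_bump_le1.
apply: le_trans (le_normr_Rintegral measurableT hi) _.
apply: le_Rintegral => //; [exact: integrable_norm|exact: integrable_norm|].
by move=> x _; rewrite normrM -[leRHS]mul1r ler_wpM2r// normr_bump_le1.
Qed.

(** The multiplication formula puts the transform on the dilated bump, whose support has radius 1/s.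
    For |y| <= 1 the phase 2 pi y x is then at most 2 pi / s <= 1 in absolute value, so there is no
    cancellation, and the transform is at least m/s: the integrand is at least [m] on an interval of
    length 1/s. This is the origin of the threshold 2 pi and of the constant, [m] times the integral
    of [bump]. *)
Lemma corr_ge : exists2 k : R, 0 < k & forall s, 2 * pi <= s -> k / s <= corr s.
Proof.
have ib : expR (- 4) <= \int[mu]_x bump x.
  have := @Rintegral_ge_cst _ bump (- 2^-1) 2^-1 (expR (- 4)) integrable_bump.
  rewrite (_ : 2^-1 - - 2^-1 = 1); last by field.
  rewrite mulr1; apply; [exact: bump_ge0 | lra |].
  by move=> x x1; apply: bump_ge; rewrite ler_norml.
exists (m * \int[mu]_x bump x).
  by rewrite mulr_gt0// (lt_le_trans _ ib)// expR_gt0.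
move=> s ps; have s0 : 0 < s by apply: lt_le_trans ps.
have si := integrable_bump_dilate s0.
rewrite /corr (Rintegral_cos_swap si integrable_bump).
rewrite mulrAC -RintegralZl//; last exact: integrable_bump.
apply: le_Rintegral => //.
- exact: integrableZ integrable_bump.
- apply: (le_integrableR _ (integrableZ (\int[mu]_x `|bump (s * x)|) integrable_bump)) => [|y].
    apply: measurable_funM; first exact: integrable_measurable integrable_bump.
    exact: measurable_fcos.
  rewrite mulrC !normrM ler_wpM2r//.
  by apply: le_trans (normr_fcos _ si) (ler_norm _).
move=> y _; rewrite mulrC.
have [y1|y1] := leP 1 `|y|; first by rewrite bump_out// !mul0r.
rewrite ler_wpM2l ?bump_ge0//.
have small x : `|s * x| <= 1 -> `|2 * pi * y * x| <= 1.
  rewrite !normrM => sx; apply: le_trans sx.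
  rewrite (gtr0_norm s0) -(normrM 2) (gtr0_norm two_pi_gt0) ler_wpM2r//.
  by apply: le_trans ps; rewrite -[leRHS]mulr1 ler_wpM2l// ltW.
have := @Rintegral_ge_cst _ (fun x => cos (2 * pi * y * x) * bump (s * x))
  (- (2 * s)^-1) (2 * s)^-1 m (integrable_cosM _ si).
rewrite (_ : (2 * s)^-1 - - (2 * s)^-1 = s^-1); last by field; rewrite gt_eqF.
apply.
- by move=> x; apply: cos_bump_ge0; exact: small.
- by rewrite lerNl ge0_cp ?invr_ge0 ?mulr_ge0 ?(ltW s0).
- move=> x x1; have {}x1 : `|s * x| <= 2^-1.
    rewrite normrM (gtr0_norm s0) -ler_pdivlMl// -invfM mulrC.
    by rewrite ler_norml.
  by apply: cos_bump_ge => //; apply: small; apply: le_trans x1 _; lra.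
Qed.

End inversion.

(** * Tensor products of test functions *)

Section tensor.
Context {R : realType} {n : nat}.
Local Notation E := 'rV[R]_n.
Implicit Types (f h : 'I_n -> R -> R) (s : seq 'I_n) (i j : 'I_n).

Definition tensor f (z : E) : R := \prod_i f i (z ord0 i).

Lemma continuous_tensor f : (forall i, continuous (f i)) -> continuous (tensor f).
Proof.
move=> cf z; rewrite /tensor; elim: (index_enum _) => [|i s ih].
  rewrite (_ : (fun z => _) = cst 1); first exact: cst_continuous.
  by apply/funext => y; rewrite big_nil.
rewrite (_ : (fun z => _) =
    (fun y : E => f i (y ord0 i) * \prod_(j <- s) f j (y ord0 j))).
  have ci : continuous (fun y : E => f i (y ord0 i)).
    by move=> y; apply: continuous_comp; [exact: coord_continuous | exact: cf].
  exact: continuousM (ci z) ih.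
by apply/funext => y; rewrite big_cons.
Qed.

Lemma is_derive_tensor f i (z : E) : derivable (f i) (z ord0 i) 1 ->
  is_derive z (delta_mx ord0 i) (tensor f)
    (tensor (fun j => if j == i then (f i)^`() else f j) z).
Proof.
move=> fd; set v := delta_mx ord0 i.
pose c := \prod_(j < n | j != i) f j (z ord0 j).
have zc (y : R) : tensor f (y *: v + z) = f i (y + z ord0 i) * c.
  rewrite /tensor (bigD1 i)//= !mxE !eqxx mulr1; congr (_ * _).
  apply: eq_bigr => j ji; rewrite !mxE eqxx (negbTE ji) mulr0 add0r.
  by [].
have z0 : tensor f z = f i (z ord0 i) * c by rewrite -(add0r z) -{1}(scale0r v) zc !mxE !add0r.
have -> : tensor (fun j => if j == i then (f i)^`() else f j) z =
    (f i)^`() (z ord0 i) * c.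
  rewrite /tensor (bigD1 i)//= eqxx; congr (_ * _).
  by apply: eq_bigr => j /negbTE ->.
have h : (fun y : R => y^-1 *: ((tensor f \o shift z) (y *: v) - tensor f z))
    y @[y --> 0^'] --> (f i)^`() (z ord0 i) * c.
  rewrite (_ : (fun y : R => _) = (fun y => (y^-1 *:
      ((f i \o shift (z ord0 i)) (y *: 1) - f i (z ord0 i))) * c)); last first.
    apply/funext => y; rewrite /= zc z0 -mulrBl /GRing.scale/= mulr1 mulrA.
    by [].
  apply: cvgM; last exact: cvg_cst.
  by rewrite derive1E; exact: fd.
split; first by apply/cvg_ex; exists ((f i)^`() (z ord0 i) * c).
exact/cvg_lim.
Qed.

(** Only the number of occurrences of each index in [s] matters. This reduces smoothness and the
    Schwartz seminorms to statements about one variable. *)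
Lemma iter_partial_tensor f s : (forall i, smooth1 (f i)) ->
  iter_partial s (tensor f) = tensor (fun i => (f i)^`(count_mem i s)).
Proof.
move=> sf; elim: s => [|i s ih] //=.
rewrite ih; apply/funext => z.
have fd := smooth1_derivable (count_mem i s) (z ord0 i) (sf i).
have [_ ->] := @is_derive_tensor (fun j => (f j)^`(count_mem j s)) i z fd.
congr tensor; apply/funext => j; rewrite eq_sym.
by case: eqP => [->|_]; rewrite ?add1n ?add0n// derive1nS.
Qed.

Lemma smooth_tensor f : (forall i, smooth1 (f i)) -> smooth (tensor f).
Proof.
move=> sf s; rewrite (iter_partial_tensor s sf); split.
  by apply: continuous_tensor => i; exact: smooth1_continuous.
move=> i z.
have fd := smooth1_derivable (count_mem i s) (z ord0 i) (sf i).
by have [] := @is_derive_tensor (fun j => (f j)^`(count_mem j s)) i z fd.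
Qed.

Lemma iter_partial0 s : iter_partial s (fun _ : E => 0 : R) = (fun=> 0).
Proof.
elim: s => //= i s ->; apply/funext => z; exact: derive_cst.
Qed.

Lemma smooth0 : smooth (fun _ : E => 0 : R).
Proof.
move=> s; rewrite iter_partial0; split=> [z|i z]; first exact: cst_continuous.
exact: derivable_cst.
Qed.

Lemma bounded_csupp (f : R -> R) (L : R) : continuous f ->
  (forall x, L <= `|x| -> f x = 0) -> exists B : R, forall x, `|f x| <= B.
Proof.
move=> cf fL.
have [L0|L0] := leP L 0.
  by exists 0 => x; rewrite fL ?normr0// (le_trans L0).
have LL : - L <= L by lra.
have cnf : {within `[- L, L], continuous (fun x => `|f x|)}.
  apply: continuous_subspaceT => x.
  by apply: continuous_comp; [exact: cf | exact: norm_continuous].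
have [c _ hc] := EVT_max LL cnf.
exists `|f c| => x; have [xL|Lx] := leP `|x| L; last by rewrite fL ?normr0// ltW.
by apply: hc; rewrite in_itv/= -ler_norml.
Qed.

Lemma derive1n_supp (f : R -> R) (L : R) k : (forall x, L <= `|x| -> f x = 0) ->
  forall x, L + k%:R <= `|x| -> f^`(k) x = 0.
Proof.
move=> fL; elim: k => [|k ih] x; first by rewrite addr0 derive1n0; exact: fL.
rewrite derive1nS => kx; apply: (derive1_supp ih).
by rewrite -addrA -natr1 addrA in kx *.
Qed.

Variables (f : 'I_n -> R -> R) (L : R).
Hypothesis sf : forall i, smooth1 (f i).
Hypothesis fL : forall i x, L <= `|x| -> f i x = 0.

Let F (z : E) : R[i] := (tensor f z)%:C%C.

Lemma Csmooth_tensor : Csmooth F.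
Proof. by split; [exact: smooth_tensor | exact: smooth0]. Qed.

(** Each weight factors over the coordinates into functions x^a f^(c)(x), which are continuous with
    compact support and hence bounded. *)
Lemma schwartz_tensor : schwartz F.
Proof.
split; first exact: Csmooth_tensor.
move=> alpha s.
have /choice[B hB] : forall i, exists B : R, forall x : R,
    `|x ^+ alpha i * (f i)^`(count_mem i s) x| <= B.
  move=> i; apply: (@bounded_csupp _ (L + (count_mem i s)%:R)).
    move=> x; apply: cvgM; last exact: smooth1_continuous.
    exact: exprn_continuous.
  by move=> x xL; rewrite (derive1n_supp (fL i) xL) mulr0.
exists (\prod_i B i) => z.
rewrite /schwartz_weight /Citer_partial (iter_partial_tensor s sf) /=.
rewrite iter_partial0 expr0n addr0 sqrtr_sqr -normrM /tensor -big_split/=.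
by rewrite normr_prod; apply: ler_prod => i _; rewrite normr_ge0 hB.
Qed.

Lemma box_compact : compact [set z : E | forall i, `[- L, L]%classic (z ord0 i)].
Proof. by apply: (@rV_compact _ _ (fun=> `[- L, L]%classic)) => i; exact: segment_compact. Qed.

Lemma tensor_supp (z : E) : tensor f z != 0 -> forall i, `[- L, L]%classic (z ord0 i).
Proof.
move=> fz i; rewrite /= in_itv/= -ler_norml leNgt; apply/negP => Lz.
by move/eqP: fz; apply; rewrite /tensor (bigD1 i)//= fL ?mul0r// ltW.
Qed.

Lemma test_function_tensor : test_function F.
Proof.
split; first exact: Csmooth_tensor.
apply: (subclosed_compact _ box_compact); first exact: closed_closure.
have -> : [set z : E | forall i, `[- L, L]%classic (z ord0 i)] =
    closure [set z : E | forall i, `[- L, L]%classic (z ord0 i)].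
  apply/closure_id; apply: compact_closed box_compact.
  exact: norm_hausdorff.
apply: closure_subset => z /= Fz; apply: tensor_supp.
by apply: contraNN Fz => /eqP z0; rewrite /F z0.
Qed.

End tensor.

(** * The family of test functions *)

Section pairing.
Context {R : realType} {d : nat}.
Local Notation mu := (@lebesgue_measure R).
Local Notation M := (measurableTypeR R).
Local Notation lambda := (@lebesgue_tuple R).
Local Notation Rintegrable f := (mu.-integrable setT (EFin \o f)).
Local Notation bump := (@bump R).
Implicit Types (a b : 'I_d -> R -> R) (k : 'I_d -> R).

(** The first half of the indices carries x and the second omega, as in [row_mx x omega]. The type
    [T] is general because both factor functions and frequencies are assembled this way. *)
Definition joint T (a b : 'I_d -> T) (i : 'I_(d + d)) : T :=
  match fintype.split i with inl j => a j | inr j => b j end.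

Lemma joint_lshift T (a b : 'I_d -> T) j : joint a b (lshift d j) = a j.
Proof. by rewrite /joint (unsplitK (inl j)). Qed.

Lemma joint_rshift T (a b : 'I_d -> T) j : joint a b (rshift d j) = b j.
Proof. by rewrite /joint (unsplitK (inr j)). Qed.

Lemma joint_ind T (P : T -> Prop) (a b : 'I_d -> T) :
  (forall j, P (a j)) -> (forall j, P (b j)) -> forall i, P (joint a b i).
Proof. by move=> Pa Pb i; rewrite /joint; case: fintype.split. Qed.

Lemma prod_joint T (a b : 'I_d -> T) (F : 'I_(d + d) -> T -> R) :
  \prod_i F i (joint a b i) =
  (\prod_j F (lshift d j) (a j)) * \prod_j F (rshift d j) (b j).
Proof.
by rewrite big_split_ord; congr (_ * _); apply: eq_bigr => j _;
  rewrite ?joint_lshift ?joint_rshift.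
Qed.

Variable k : 'I_d -> R.
Hypothesis k0 : forall j, 0 < k j.

Let f : 'I_(d + d) -> R -> R := joint (fun j x => bump (k j * x)) (fun=> bump).

Let G (z : 'rV[R]_(d + d)) : R[i] := (tensor f z)%:C%C.

Let fi i : Rintegrable (f i).
Proof.
apply: (@joint_ind _ (fun g => Rintegrable g)) => j.
  exact: integrable_bump_dilate.
exact: integrable_bump.
Qed.

Let fN i x : f i (- x) = f i x.
Proof.
apply: (@joint_ind _ (fun g : R -> R => g (- x) = g x)) => j; last exact: bumpN.
by rewrite mulrN bumpN.
Qed.

(** The symplectic form pairs the x-half of one point with the omega-half of the other, so the
    transforms of the factors of [f] appear with the halves exchanged. *)
Let h : 'I_(d + d) -> R -> R :=
  joint (fun=> fcos bump) (fun j => fcos (fun x => bump (k j * x))).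

Let smooth1_bump_dilate (c : R) : smooth1 (fun x => bump (c * x)).
Proof.
have := smooth1_affine c 0 (@smooth1_bump R).
by congr smooth1; apply/funext => x; rewrite addr0.
Qed.

Let integrable_fcos_bump_dilate (c : R) : 0 < c ->
  Rintegrable (fcos (fun x => bump (c * x))).
Proof.
move=> c0; have cV0 : 0 < c^-1 by rewrite invr_gt0.
exact: integrable_fcos (smooth1_bump_dilate c) cV0 (fun x => bump_dilate_out c0).
Qed.

Let hi i : Rintegrable (h i).
Proof.
apply: (@joint_ind _ (fun g => Rintegrable g)) => j; first exact: integrable_fcos_bump.
exact: integrable_fcos_bump_dilate.
Qed.

Let dott (t : (d + d).-tuple M) : R :=
  \sum_j tnth t (lshift d j) * tnth t (rshift d j).

(** As [G] is real-valued, the real part replaces the exponential by a cosine, and the evenness of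
    the factors splits the integral over the coordinates. *)
Lemma Re_sympl_fourier_tensor (t : (d + d).-tuple M) :
  complex.Re (sympl_fourier G (- rowt t)) = \prod_i h i (tnth t i).
Proof.
(* For z = (x, omega) and u = (u1, u2), the phase -2 pi sigma(-z, u) is 2 pi (omega u1 - x u2);
   these are its coefficients. *)
pose th : 'I_(d + d) -> R := joint (fun j => 2 * pi * tnth t (rshift d j))
  (fun j => - (2 * pi * tnth t (lshift d j))).
have := Rintegral_tensor_cos th 0 fi fN; rewrite cos0 mul1r.
rewrite (_ : \prod_i \int[mu]_x _ = \prod_i h i (tnth t i)); last first.
  rewrite (prod_joint _ _ (fun i v => v (tnth t i))) big_split_ord mulrC.
  congr (_ * _); apply: eq_bigr => j _; rewrite /th /f ?joint_lshift ?joint_rshift.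
    by [].
  by rewrite -[RHS]fcosN; apply: eq_Rintegral => x _; rewrite mulrN.
move=> <-; rewrite /sympl_fourier /Cintegral /=; apply: eq_Rintegral => u _.
rewrite mulr0 subr0 add0r; congr (cos _ * _); last first.
  by apply: eq_bigr => i _; rewrite !mxE.
rewrite /sympl /dotv big_split_ord/= -mulrN opprB mulrBr addrC; congr (_ + _).
  rewrite mulr_sumr; apply: eq_bigr => j _.
  by rewrite /th joint_rshift !mxE; ring.
rewrite -mulrN -sumrN mulr_sumr; apply: eq_bigr => j _.
by rewrite /th joint_lshift !mxE; ring.
Qed.

(** The interval of integration is written as an indicator so that it can be the integrable factor
    in [Rfubini_kernel]. *)
Lemma sinc_integral (v : R) :
  sinc v = \int[mu]_x (cos (pi * x * v) * \1_(`[0, 1]%classic : set M) x).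
Proof.
transitivity (\int[mu]_(x in `[0, 1]) cos (pi * v * x)); last first.
  rewrite Rintegral_mkcond; apply: eq_Rintegral => x _.
  by rewrite patchE indicE; case: ifPn => _ /=; rewrite ?mulr1 ?mulr0// mulrAC.
rewrite /sinc; have [->|v0] := eqVneq v 0.
  under eq_Rintegral do rewrite mulr0 mul0r cos0.
  by rewrite Rintegral_cst// /= lebesgue_measure_itv/= lte_fin ltr01 oppr0 adde0 mulr1.
have pv : pi * v != 0 by rewrite mulf_neq0// gt_eqF// pi_gt0.
have dS (x : R) : is_derive x 1 (fun x => (pi * v)^-1 * sin (pi * v * x)) (cos (pi * v * x)).
  have hk : is_derive x 1 ( *%R (pi * v)) (pi * v).
    by have := is_deriveZ (pi * v) (@is_derive_id _ _ x 1); rewrite /GRing.scale/= mulr1.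
  have hs : is_derive x 1 (fun x => sin (pi * v * x)) (cos (pi * v * x) * (pi * v)).
    exact: (is_derive1_comp (is_derive_sin (pi * v * x)) hk).
  have := is_deriveZ (pi * v)^-1 hs.
  by rewrite /GRing.scale/= mulrCA mulVf// mulr1.
have cS (x : R) : {for x, continuous (fun x => (pi * v)^-1 * sin (pi * v * x))}.
  by apply/differentiable_continuous/derivable1_diffP; case: (dS x).
rewrite /Rintegral (@continuous_FTC2 _ _ (fun x => (pi * v)^-1 * sin (pi * v * x)))//.
- by rewrite /= mulr1 mulr0 sin0 mulr0 subr0 mulrC.
- by apply: continuous_subspaceT; exact: continuous_cosM.
- split; first by move=> x _; case: (dS x).
  + by apply: cvg_at_right_filter; exact: cS.
  + by apply: cvg_at_left_filter; exact: cS.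
- by move=> x _; rewrite derive1E; case: (dS x).
Qed.

Let C : R := (\int[mu]_x fcos bump x) / bump 0.

(** The omega-integral is a second cosine transform of the dilated bumps, at frequencies y x_j / 2;
    inversion returns C phi(k_j y x_j / 2). The remaining x-integral then factors into values of
    [corr]. The division by 2 compares the phase pi of sinc with the phase 2 pi of [fcos]. *)
Let inner (y : R) :
  \int[lambda (d + d)]_t (cos (pi * y * dott t) * \prod_i h i (tnth t i)) =
  \prod_j (C * corr (k j * (y / 2))).
Proof.
have mP := integrable_measurable (integrable_tensor hi).
have mdott : measurable_fun setT dott.
  by apply: measurable_Rsum => j; apply: measurable_funM; exact: measurable_tnth.
rewrite (@Rintegral_transfer _ _ _ _ _ (lambda d \x lambda d)%E (lambda (d + d)) _
  (@ge0_integral_tcat R d d)); last first.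
  by apply: measurable_funM => //; apply: measurable_cos_fun; exact: measurable_funM.
pose c (p : d.-tuple M * d.-tuple M) :=
  cos (pi * y * \sum_j tnth p.1 j * tnth p.2 j).
have mc : measurable_fun setT c.
  apply: measurable_cos_fun; apply: measurable_funM => //.
  apply: measurable_Rsum => j; apply: measurable_funM.
    exact: (measurableT_comp (measurable_tnth j) measurable_fst).
  exact: (measurableT_comp (measurable_tnth j) measurable_snd).
pose hr j := fcos (fun x => bump (k j * x)).
have hri j : Rintegrable (hr j) by exact: integrable_fcos_bump_dilate.
have bi := @integrable_fcos_bump R.
transitivity (\int[lambda d]_s ((\prod_j fcos bump (tnth s j)) *
    \int[lambda d]_u (c (s, u) * \prod_j hr j (tnth u j)))).
  rewrite Rfubini_kernel1//; first last.
  - by move=> p; exact: cos_max.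
  - exact: integrable_tensor.
  - exact: (integrable_tensor (fun=> bi)).
  apply: eq_Rintegral => p _; rewrite (prod_joint _ _ (fun i v => v (tnth (tcat p) i))).
  rewrite mulrCA; congr (_ * (_ * _)).
  - by apply: eq_bigr => j _; rewrite tnth_tcatl.
  - congr (cos (_ * _)); apply: eq_bigr => j _.
    by rewrite tnth_tcatl tnth_tcatr.
  - by apply: eq_bigr => j _; rewrite tnth_tcatr.
have inv j (v : R) : fcos (hr j) v = C * bump (k j * v).
  have kV0 : 0 < (k j)^-1 by rewrite invr_gt0.
  have := @fcos_inversion _ (fun x => bump (k j * x)) _ v (smooth1_bump_dilate (k j)) kV0
    (fun x => bump_dilate_out (k0 j)).
  move=> e; apply: (mulfI (lt0r_neq0 (@bump0_gt0 R))); rewrite e.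
  - by rewrite /C; field; rewrite gt_eqF ?bump0_gt0.
  - by move=> x; exact: normr_bump_le1.
  - by move=> x; rewrite mulrN bumpN.
have ii j : Rintegrable (fun x => bump (k j * (y / 2) * x) * fcos bump x).
  apply: (le_integrableR _ bi) => [|x].
    apply: measurable_funM; last exact: integrable_measurable bi.
    by apply: measurable_continuous; exact: continuous_bump_dilate.
  by rewrite normrM -[leRHS]mul1r ler_wpM2r// normr_bump_le1.
transitivity (\int[lambda d]_s \prod_j
    (C * (bump (k j * (y / 2) * tnth s j) * fcos bump (tnth s j)))).
  apply: eq_Rintegral => s _.
  have -> : \int[lambda d]_u (c (s, u) * \prod_j hr j (tnth u j)) =
      \prod_j (C * bump (k j * (y / 2) * tnth s j)).
    have := Rintegral_tensor_cos (fun j => pi * y * tnth s j) 0 hri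
      (fun j => fcosN (fun x => bump (k j * x))).
    rewrite cos0 mul1r => e.
    transitivity (\prod_j \int[mu]_x (cos (pi * y * tnth s j * x) * hr j x)).
      rewrite -e; apply: eq_Rintegral => u _; congr (cos _ * _).
      by rewrite add0r mulr_sumr; apply: eq_bigr => j _; rewrite mulrA.
    apply: eq_bigr => j _.
    have -> : k j * (y / 2) * tnth s j = k j * (y / 2 * tnth s j) by rewrite -!mulrA.
    rewrite -inv; apply: eq_Rintegral => x _.
    by congr (cos _ * _); field.
  by rewrite -big_split/=; apply: eq_bigr => j _; ring.
rewrite (@Rintegral_tensor _ _ (fun j x => C * (bump (k j * (y / 2) * x) * fcos bump x))).
- by apply: eq_bigr => j _; rewrite RintegralZl.
- by move=> j; exact: integrableZ.
- by move=> j x; rewrite mulrN bumpN fcosN.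
Qed.

(** The left side is the real part of Theta_sigma(G), written with the transposed symplectic
    transform. *)
Lemma Re_pairing (I01 := \1_(`[0, 1]%classic : set M) : R -> R) :
  complex.Re (regular_distribution (@Theta R d) (fun z => sympl_fourier G (- z))) =
  \int[mu]_y (I01 y * \prod_j (C * corr (k j * (y / 2)))).
Proof.
have Pi := integrable_tensor hi.
have I01i : Rintegrable I01.
  exact: (@integrable_indic_itv R 0 1 true false).
have ReM (x : R) (w : R[i]) : complex.Re (x%:C%C * w) = x * complex.Re w.
  by case: w => p q /=; rewrite mul0r subr0.
transitivity (\int[lambda (d + d)]_t
    complex.Re (Theta (rowt t) * sympl_fourier G (- rowt t))) => //.
transitivity (\int[lambda (d + d)]_t ((\prod_i h i (tnth t i)) *
    \int[mu]_y (cos (pi * y * dott t) * I01 y))).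
  apply: eq_Rintegral => t _.
  rewrite -Re_sympl_fourier_tensor -sinc_integral /Theta ReM mulrC.
  congr (_ * sinc _).
  by apply: eq_bigr => j _; rewrite !mxE.
have mdott : measurable_fun setT dott.
  by apply: measurable_Rsum => j; apply: measurable_funM; exact: measurable_tnth.
have mc : measurable_fun setT
    (fun p : (d + d).-tuple M * M => cos (pi * p.2 * dott p.1)).
  apply: measurable_cos_fun; apply: measurable_funM.
    by apply: measurable_funM => //; exact: measurable_cst.
  exact: (measurableT_comp mdott measurable_fst).
apply: (etrans (Rfubini_kernel Pi I01i mc (fun p => cos_max _))).
by apply: eq_Rintegral => y _; congr (_ * _); exact: inner.
Qed.

(** Integrability of [u] is a consequence: the almost everywhere bound is first integrated for |u|
    in the extended reals, where it needs only measurability. *)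
Lemma ae_le_normr_Rintegral n (u v : n.-tuple M -> R) : measurable_fun setT u ->
  (lambda n).-integrable setT (EFin \o v) -> (forall t, 0 <= v t) ->
  {ae lambda n, forall t, `|u t| <= v t} ->
  `|\int[lambda n]_t u t| <= \int[lambda n]_t v t.
Proof.
move=> mu_ vi v0 uv.
have le : (\int[lambda n]_t `|(u t)%:E| <= \int[lambda n]_t (v t)%:E)%E.
  apply: ae_ge0_le_integral => //.
  - by apply/measurable_EFinP; exact: measurableT_comp.
  - by move=> t _; rewrite lee_fin.
  - by apply/measurable_EFinP; exact: integrable_measurable vi.
  - by apply: filterS uv => t uvt _; rewrite lee_fin.
have ui : (lambda n).-integrable setT (EFin \o u).
  apply/integrableP; split; first exact/measurable_EFinP.
  by apply: le_lt_trans le _; rewrite -EFin_Rintegral// ltry.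
apply: le_trans (le_normr_Rintegral measurableT ui) _.
by rewrite -lee_fin !EFin_Rintegral//; exact: integrable_norm.
Qed.

(** Since [tensor f] vanishes off [K], the bound on [K] is enough. The factor after [B] is the L^1
    norm of G: as the bumps are nonnegative it is a product of one-dimensional integrals, each
    dilation contributing 1/k_j. *)
Lemma Re_regular_le (F : 'rV[R]_(d + d) -> R[i]) (B : R) (K : set 'rV[R]_(d + d)) :
  Cmeasurable F -> 0 <= B ->
  {ae lambda (d + d), forall t, K (rowt t) -> Normc.normc (F (rowt t)) <= B} ->
  (forall z, tensor f z != 0 -> K z) ->
  `|complex.Re (regular_distribution F G)| <=
    B * ((\prod_j (k j)^-1) * (\int[mu]_x bump x) ^+ (d + d)).
Proof.
move=> [mRe mIm] B0 FB fK.
have f0 i x : 0 <= f i x.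
  by apply: (@joint_ind _ (fun g : R -> R => 0 <= g x)) => j; exact: bump_ge0.
have Gi := integrable_tensor fi.
have -> : B * ((\prod_j (k j)^-1) * (\int[mu]_x bump x) ^+ (d + d)) =
    \int[lambda (d + d)]_t (B * \prod_i f i (tnth t i)).
  rewrite RintegralZl// Rintegral_tensor// (prod_joint _ _ (fun _ g => \int[mu]_x g x)).
  congr (_ * _).
  have dil j : \int[mu]_x bump (k j * x) = (k j)^-1 * \int[mu]_x bump x.
    have [_ ->] := integrable_affine 0 (k0 j) (@integrable_bump R).
    rewrite mulKf ?gt_eqF//.
    by apply: eq_Rintegral => x _; rewrite addr0.
  under [X in _ = X * _]eq_bigr do rewrite dil.
  by rewrite big_split/= !prodr_const !card_ord exprD mulrA.
have tE t : tensor f (rowt t) = \prod_i f i (tnth t i).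
  by apply: eq_bigr => i _; rewrite mxE.
rewrite /regular_distribution /Cintegral /=.
rewrite (_ : Rintegral _ _ _ = \int[lambda (d + d)]_t
    (complex.Re (F (rowt t)) * \prod_i f i (tnth t i))); last first.
  apply: eq_Rintegral => t _; rewrite -tE /G.
  by case: (F _) => p q /=; rewrite mulr0 subr0.
apply: ae_le_normr_Rintegral.
- by apply: measurable_funM => //; exact: integrable_measurable Gi.
- have := integrableZl measurableT B Gi.
  by congr integrable; apply/funext => t /=.
- by move=> t; rewrite mulr_ge0// prodr_ge0.
- apply: filterS FB => t FB.
  rewrite normrM [X in _ * X]ger0_norm ?prodr_ge0//.
  have [z0|nz] := eqVneq (tensor f (rowt t)) 0; first by rewrite -tE z0 !mulr0.
  rewrite ler_wpM2r ?prodr_ge0//; apply: le_trans (FB (fK _ nz)).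
  case: (F _) => p q /=; rewrite -sqrtr_sqr.
  by rewrite ler_wsqrtr// lerDl sqr_ge0.
Qed.

End pairing.

(** * Logarithmic divergence *)

Section divergence.
Context {R : realType}.
Local Notation mu := (@lebesgue_measure R).
Local Notation M := (measurableTypeR R).
Local Notation Rintegrable f := (mu.-integrable setT (EFin \o f)).

Lemma integrable_indicR (a b : R) :
  Rintegrable (\1_(`[a, b]%classic : set M) : R -> R).
Proof. exact: (@integrable_indic_itv R a b true false). Qed.

Lemma Rintegral_indic_itv (a b : R) : a <= b ->
  \int[mu]_x (\1_(`[a, b]%classic : set M) x : R) = b - a.
Proof.
move=> ab; rewrite /Rintegral integral_indic//= setIT lebesgue_measure_itv/= lte_fin.
by case: ltP => //= ba; apply/eqP; rewrite eq_sym subr_eq0 eq_le ab ba.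
Qed.

Lemma indicE_itv (a b x : R) :
  \1_(`[a, b]%classic : set M) x = (a <= x <= b)%R%:R :> R.
Proof. by rewrite indicE; congr (nat_of_bool _)%:R; rewrite mem_setE in_itv. Qed.

Lemma Rintegral_inv (a : R) : 0 < a < 1 ->
  Rintegrable (fun x => x^-1 * \1_(`[a, 1]%classic : set M) x) /\
  \int[mu]_x (x^-1 * \1_(`[a, 1]%classic : set M) x) = - ln a.
Proof.
move=> /andP[a0 a1].
have E (x : R) : x^-1 * \1_(`[a, 1]%classic : set M) x =
    ((@GRing.inv R) \_ `[a, 1]%classic) x.
  by rewrite patchE indicE; case: ifPn => _; rewrite ?mulr1 ?mulr0.
have cV : {within `[a, 1], continuous (@GRing.inv R)}.
  apply: continuous_in_subspaceT => x; rewrite inE/= in_itv/= => /andP[ax _].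
  by apply: inv_continuous; rewrite gt_eqF// (lt_le_trans a0).
split.
  have vi : mu.-integrable `[a, 1] (EFin \o (@GRing.inv R)).
    by apply: continuous_compact_integrable => //; exact: segment_compact.
  have := (@integrable_mkcond _ M R mu `[a, 1]%classic (EFin \o (@GRing.inv R))
    (measurable_itv _)).1 vi; congr integrable.
  by apply/funext => x; rewrite /= E !patchE; case: ifPn.
transitivity (\int[mu]_(x in `[a, 1]) x^-1).
  by rewrite [RHS]Rintegral_mkcond; apply: eq_Rintegral => x _; rewrite E.
have dln (x : R) : 0 < x -> is_derive x 1 (@ln R) x^-1 by exact: is_derive1_ln.
have cln (x : R) : 0 < x -> {for x, continuous (@ln R)}.
  by move=> x0; apply/differentiable_continuous/derivable1_diffP; case: (dln x x0).
rewrite /Rintegral (@continuous_FTC2 _ _ (@ln R))//.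
- by rewrite /= ln1 sub0r.
- split.
  + by move=> x; rewrite in_itv/= => /andP[ax _]; case: (dln x (lt_trans a0 ax)).
  + by apply: cvg_at_right_filter; exact: cln.
  + by apply: cvg_at_left_filter; exact: cln.
- by move=> x; rewrite in_itv/= => /andP[ax _]; rewrite derive1E; case: (dln x (lt_trans a0 ax)).
Qed.

Lemma normr_corr_prod n (s t : R) :
  `|corr s * corr t ^+ n| <= (\int[mu]_x `|fcos bump x|) ^+ n.+1.
Proof.
have K0 : 0 <= \int[mu]_x `|fcos bump x| by exact: Rintegral_ge0.
rewrite normrM normrX exprS; apply: ler_pM; rewrite ?exprn_ge0 ?normr_corr//.
by rewrite lerXn2r ?nnegrE ?normr_corr.
Qed.

Lemma integrable_corr_prod n (a b : R) :
  Rintegrable (fun y => \1_(`[0, 1]%classic : set M) y *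
    (corr (a * (y / 2)) * corr (b * (y / 2)) ^+ n)).
Proof.
set K := (\int[mu]_x `|fcos bump x|) ^+ n.+1.
have cl (k : R) : continuous (fun y : R => corr (k * (y / 2))).
  move=> y; apply: (@continuous_comp _ _ _ (fun y : R => k * (y / 2)) corr);
    last exact: continuous_corr.
  rewrite (_ : (fun y => _) = ( *%R (k / 2))); first exact: mulrl_continuous.
  by apply/funext => z; ring.
apply: (le_integrableR _ (integrableZ K (integrable_indicR 0 1))) => [|y].
  apply: measurable_funM; first exact: integrable_measurable (integrable_indicR 0 1).
  have mc (k : R) : measurable_fun [set: M] (fun y : R => corr (k * (y / 2))).
    by apply: measurable_continuous; exact: cl.
  by apply: measurable_funM => //; exact: measurable_funX.
rewrite mulrC !normrM -normrM ler_wpM2r//.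
by apply: le_trans (normr_corr_prod _ _ _) (ler_norm _).
Qed.

(* [corr s] is bounded below by a multiple of [1/s] for large [s], so that
   [mu * corr (mu y / 2)] is comparable with [1/y] outside a neighbourhood of
   size [1/mu] of 0. *)
Lemma corr_integral_diverges n : exists (dl c c1 : R),
  [/\ 0 < dl, 0 < c, 0 <= c1 & forall X m : R, 0 < X -> m = 4 * pi * expR X ->
    c * X - c1 <= m * \int[mu]_y (\1_(`[0, 1]%classic : set M) y *
      (corr (m * (y / 2)) * corr (dl * (y / 2)) ^+ n))].
Proof.
have c0 := @corr0_gt0 R.
(* This radius is returned as [dl]: for y in [0, 1] the argument [e * (y / 2)] stays below [e], so
   the n undistinguished factors keep a positive lower bound. *)
have [e e0 he] : exists2 e : R, 0 < e & forall s, `|s| < e -> corr 0 / 2 <= corr s.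
  have := @continuous_corr R 0; move=> /cvgrPdist_le /(_ (corr 0 / 2)).
  rewrite divr_gt0// => /(_ isT) /nbhs_ballP[e /= e0 he]; exists e => // s se.
  have := he s; rewrite /ball/= sub0r normrN => /(_ se).
  by rewrite ler_norml => /andP[_]; lra.
have [k k0 kc] := @corr_ge R.
set K := \int[mu]_x `|fcos bump x|.
have K0 : 0 <= K by exact: Rintegral_ge0.
pose a0 : R := corr 0 / 2; have a00 : 0 < a0 by rewrite divr_gt0.
have pi0 := @pi_gt0 R.
exists e, (2 * k * a0 ^+ n), (4 * pi * K ^+ n.+1); split => //.
- by rewrite !mulr_gt0// exprn_gt0.
- by rewrite !mulr_ge0 ?exprn_ge0// ltW.
move=> X m X0 mE.
have eX0 := expR_gt0 X.
have m0 : 0 < m by rewrite mE !mulr_gt0.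
(* The condition y >= ep is equivalent to m y / 2 >= 2 pi, the threshold of [corr_ge], and the
   integral of 1/y over [ep, 1] is exactly [X]. *)
pose ep : R := expR (- X).
have ep0 : 0 < ep by exact: expR_gt0.
have ep1 : ep < 1 by rewrite expR_lt1 oppr_lt0.
have mep : m * ep = 4 * pi by rewrite mE /ep -mulrA -expRD subrr expR0 mulr1.
pose f (y : R) := corr (m * (y / 2)) * corr (e * (y / 2)) ^+ n.
have fK y : `|f y| <= K ^+ n.+1 by exact: normr_corr_prod.
have fi : Rintegrable (fun y => \1_(`[0, 1]%classic : set M) y * f y).
  exact: integrable_corr_prod.
have ep01 : 0 < ep < 1 by rewrite ep0.
have [vi ve] := Rintegral_inv ep01.
have ii := integrable_indicR 0 ep.
(* A minorant of the integrand: the main term lives on [ep, 1], and on [0, ep] the crude bound on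
   |f| is subtracted, at total cost m ep K^(n+1) = 4 pi K^(n+1). At the common endpoint both terms
   are present, which only lowers the minorant. *)
pose g (y : R) : R := 2 * k * a0 ^+ n * (y^-1 * \1_(`[ep, 1]%classic : set M) y) -
  m * K ^+ n.+1 * \1_(`[0, ep]%classic : set M) y.
have -> : 2 * k * a0 ^+ n * X - 4 * pi * K ^+ n.+1 = \int[mu]_y g y.
  rewrite RintegralB//; [|exact: integrableZ|exact: integrableZ].
  rewrite !RintegralZl// ve Rintegral_indic_itv ?ltW// subr0 expRK opprK.
  by rewrite -mep; ring.
rewrite -RintegralZl//; apply: le_Rintegral => //.
- have := integrableB measurableT (integrableZ (2 * k * a0 ^+ n) vi)
    (integrableZ (m * K ^+ n.+1) ii).
  by congr integrable; apply/funext.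
- exact: integrableZ.
move=> y _; rewrite /g !indicE_itv -/(f y).
have [y0|y0] /= := leP 0 y; last first.
  rewrite [ep <= y]leNgt (lt_trans y0 ep0)/=.
  by rewrite !(mulr0, mul0r) subrr.
have mfK : - (m * K ^+ n.+1) <= m * f y.
  rewrite -mulrN ler_pM2l//; have := fK y; rewrite ler_norml => /andP[]//.
have [epy|yep] := leP ep y; last first.
  have -> : (y <= 1) = true by apply/ltW/(lt_trans yep).
  by rewrite (ltW yep) /= !mulr0 mulr1 sub0r mul1r.
have [y1|y1] := leP y 1; last first.
  by rewrite [y <= ep]leNgt (lt_trans ep1 y1) /= !(mulr0, mul0r) subrr.
rewrite /= mulr1 mul1r; apply: (@le_trans _ _ (2 * k * a0 ^+ n * y^-1)).
  by rewrite lerBlDr lerDl !mulr_ge0 ?exprn_ge0// ltW.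
have ypos : 0 < y by exact: lt_le_trans epy.
have h1 : 2 * k / y <= m * corr (m * (y / 2)).
  have : 2 * pi <= m * (y / 2).
    have -> : 2 * pi = m * ep / 2 :> R by rewrite mep; field.
    by rewrite mulrA ler_pM2r ?invr_gt0// ler_pM2l.
  move=> /kc; rewrite -(ler_pM2l m0); apply: le_trans.
  by rewrite le_eqVlt; apply/orP; left; apply/eqP; field; rewrite !gt_eqF.
have h2 : a0 ^+ n <= corr (e * (y / 2)) ^+ n.
  have h3 : a0 <= corr (e * (y / 2)).
    apply: he; rewrite ger0_norm; last by rewrite mulr_ge0 ?divr_ge0// ltW.
    by rewrite gtr_pMr//; lra.
  by rewrite lerXn2r ?nnegrE// ?(ltW a00)// (le_trans _ h3)// ltW.
have -> : 2 * k * a0 ^+ n * y^-1 = 2 * k / y * a0 ^+ n by ring.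
rewrite /f [leRHS]mulrA ler_pM// ?exprn_ge0 ?(ltW a00)//.
by rewrite divr_ge0// ?mulr_ge0// ltW.
Qed.

End divergence.

(** * Contradiction between the local bound and the logarithmic growth *)

Theorem corollary3p5 (R : realType) (d : nat) (hd : (1 <= d)%N)
    (Theta_sigma : functional R (d + d))
    (hS' : tempered_distribution Theta_sigma)
    (hF : eq_distribution Theta_sigma
            (sympl_fourier_distribution (regular_distribution (@Theta R d)))) :
  ~ in_Linfty_loc Theta_sigma.
Proof.
(* With d = n + 1, one x-coordinate carries the large dilation and the other n carry [dl]. *)
case: d hd Theta_sigma hS' hF => // n _ T _ hF [F [[mF FB] TF]].
have [dl [c [c1 [dl0 c0 c10 hX]]]] := @corr_integral_diverges R n.
(* This dominates all support radii that occur, namely 1, 1/dl and 1/m <= 1, whatever [X] is. The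
   bound on the resulting box is therefore chosen before [X]. *)
pose L : R := 1 + dl^-1.
have dlV0 : 0 < dl^-1 by rewrite invr_gt0.
have [B0 hB0] := FB _ (@box_compact R (n.+1 + n.+1) L).
pose B := `|B0|.
pose C := (\int[@lebesgue_measure R]_x fcos bump x) / bump 0.
have C0 : 0 < C by rewrite divr_gt0 ?bump0_gt0 ?Rintegral_fcos_bump_gt0.
pose S := \int[@lebesgue_measure R]_x (bump x : R).
have S0 : 0 <= S by apply: Rintegral_ge0 => x _; exact: bump_ge0.
(* The bound of [Re_regular_le] multiplied by [m]: the factor 1/m of the first coordinate has
   disappeared. *)
pose D : R := B * (dl^-1 ^+ n * S ^+ (n.+1 + n.+1)).
have D0 : 0 <= D by rewrite !mulr_ge0 ?exprn_ge0 ?normr_ge0// ltW.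
have CD (X : R) : 0 < X -> C ^+ n.+1 * (c * X - c1) <= D.
  move=> X0; have := hX X _ X0 erefl; set m := 4 * pi * expR X => hm.
  have m1 : 1 <= m.
    have := @pi_ge2 R; have : 1 <= expR X.
      by apply: le_trans (expR_ge1Dx X); rewrite lerDl ltW.
    by move=> x1 p2; rewrite -[leLHS]mulr1 ler_pM//; lra.
  have m0 : 0 < m by exact: lt_le_trans m1.
  pose k (j : 'I_n.+1) := if j == ord0 then m else dl.
  have k0 j : 0 < k j by rewrite /k; case: ifP.
  pose f : 'I_(n.+1 + n.+1) -> R -> R := joint (fun j x => bump (k j * x)) (fun=> bump).
  have sf i : smooth1 (f i).
    apply: (@joint_ind _ _ (fun g => smooth1 g)) => j; last exact: smooth1_bump.
    have := smooth1_affine (k j) 0 (@smooth1_bump R).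
    by congr smooth1; apply/funext => x; rewrite addr0.
  have fL i (x : R) : L <= `|x| -> f i x = 0.
    apply: (@joint_ind _ _ (fun g : R -> R => L <= `|x| -> g x = 0)) => j Lx.
      apply: bump_dilate_out => //; apply: le_trans Lx.
      rewrite /k; case: ifP => _; last by rewrite /L lerDr.
      apply: (@le_trans _ _ 1); first by rewrite invf_le1.
        by rewrite /L lerDl ltW.
    by apply: bump_out; apply: le_trans Lx; rewrite /L lerDl ltW.
  have tG := test_function_tensor sf fL.
  have e := congr1 (@complex.Re R) (hF _ (schwartz_tensor sf fL)).
  (* The same G is tested twice: as a test function it brings in the bounded representative [F], as
     a Schwartz function it brings in the Fourier identity. *)
  rewrite TF// /sympl_fourier_distribution (Re_pairing k0) in e.
  have := @Re_regular_le R n.+1 k k0 F B [set z | forall i, `[- L, L]%classic (z ord0 i)] mF (normr_ge0 _).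
  move=> /(_ _ (tensor_supp fL)).
  have hB : {ae @lebesgue_tuple R (n.+1 + n.+1), forall t,
      [set z : 'rV[R]_(n.+1 + n.+1) | forall i, `[- L, L]%classic (z ord0 i)] (rowt t) ->
      Normc.normc (F (rowt t)) <= B}.
    by apply: filterS hB0 => t h Kt; apply: le_trans (h Kt) (ler_norm _).
  move=> /(_ hB); rewrite e.
  have -> : \prod_(j < n.+1) (k j)^-1 = m^-1 * dl^-1 ^+ n.
    rewrite big_ord_recl /k eqxx; congr (_ * _).
    transitivity (\prod_(i < n) dl^-1); first exact: eq_bigr.
    by rewrite prodr_const card_ord.
  set I := Rintegral _ _ _.
  have -> : I = C ^+ n.+1 * \int[@lebesgue_measure R]_y
      (\1_(`[0, 1]%classic : set (measurableTypeR R)) y *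
       (corr (m * (y / 2)) * corr (dl * (y / 2)) ^+ n)).
    rewrite -RintegralZl//; last exact: integrable_corr_prod.
    apply: eq_Rintegral => y _; rewrite big_split/= prodr_const card_ord -/C.
    rewrite mulrCA; congr (_ * (_ * _)); rewrite big_ord_recl /k eqxx; congr (_ * _).
    transitivity (\prod_(i < n) corr (dl * (y / 2))); first exact: eq_bigr.
    by rewrite prodr_const card_ord.
  move=> /(le_trans (ler_norm _)) h.
  apply: (@le_trans _ _ (C ^+ n.+1 * (m * _))).
    by rewrite ler_pM2l ?exprn_gt0//; exact: hm.
  rewrite mulrCA -ler_pdivlMl//; apply: le_trans h _.
  by rewrite le_eqVlt; apply/orP; left; apply/eqP; rewrite /D; ring.
have Cn := exprn_gt0 n.+1 C0.
(* Chosen so that the left side of [CD] becomes D + C^(n+1) c, which exceeds D. *)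
have X0 : 0 < (D / C ^+ n.+1 + c1) / c + 1.
  by rewrite ltr_wpDl// divr_ge0 ?addr_ge0 ?divr_ge0// ltW.
have := CD _ X0.
rewrite (_ : C ^+ n.+1 * _ = D + C ^+ n.+1 * c); last first.
  by field; rewrite !gt_eqF.
by rewrite gerDl leNgt mulr_gt0.
Qed.
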